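(* (1) Let $\lambda=m\alpha_1+n\alpha_2\in P_+\cap Q_{sh}$ and $\tilde w=t^\lambda s_1s_2s_1\tau$. Then $$f_{\tilde w,\mathbb{O}}=\begin{cases}v-v^{-1},&\mathbb{O}=\mathbb{O}_{\lambda',\tau}\text{ with }\lambda'\in E_{m\alpha_1+n\alpha_2,\tau},\\ 1,&\mathbb{O}=\mathbb{O}_{n,\tau},\\ 0,&\text{otherwise.}\end{cases}$$ (2) Let $\lambda=m\alpha_1+n\alpha_2\in P_+\cap Q_{sh}$ with $n\neq2m$, and $\tilde w=t^\lambda s_1\tau$. Then $$f_{\tilde w,\mathbb{O}}=\begin{cases}v-v^{-1},&\mathbb{O}=\mathbb{O}_{\lambda',\tau}\text{ with }\lambda'\in E'_{m\alpha_1+n\alpha_2,\tau},\\ 1,&\mathbb{O}=\mathbb{O}_{1-m,\tau},\\ 0,&\text{otherwise.}\end{cases}$$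
   Context: $W=\langle s_1,s_2\rangle$ is the finite Weyl group of type $A_2$; $\alpha_1,\alpha_2$ are the simple roots, identified with the simple coroots ($\langle\alpha_i,\alpha_i\rangle=2$, $\langle\alpha_1,\alpha_2\rangle=-1$); $Q=\mathbb{Z}\alpha_1\oplus\mathbb{Z}\alpha_2$; $P$ is the coweight lattice, $P_+$ its dominant elements; $\widetilde W=P\rtimes W$ with translations $t^\lambda$. $W_a=Q\rtimes W$ is the Coxeter group generated by $s_0=t^{\alpha_1+\alpha_2}s_1s_2s_1$, $s_1$, $s_2$; $\widetilde W=W_a\rtimes\langle\tau\rangle$ with $\tau^3=1$, $\tau s_0\tau^{-1}=s_1$, $\tau s_1\tau^{-1}=s_2$, $\tau s_2\tau^{-1}=s_0$, i.e. $\tau=t^{(2\alpha_1+\alpha_2)/3}s_1s_2$; $\ell(w\tau^j)=\ell(w)$ for $w\in W_a$. Class polynomials: $\widetilde H$ is the algebra over $\mathbb{Z}[v,v^{-1}]$ with basis $T_{\tilde w}$ ($\tilde w\in\widetilde W$), $T_{\tilde x}T_{\tilde y}=T_{\tilde x\tilde y}$ if $\ell(\tilde x)+\ell(\tilde y)=\ell(\tilde x\tilde y)$, and $(T_s-v)(T_s+v^{-1})=0$ for $s\in\{s_0,s_1,s_2\}$. $[\widetilde H,\widetilde H]$ is the submodule spanned by commutators. For a conjugacy class $\mathbb{O}$ of $\widetilde W$, $T_{\mathbb{O}}$ is the image in $\widetilde H/[\widetilde H,\widetilde H]$ of $T_{w}$ for any minimal length $w\in\mathbb{O}$; by He–Nie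 this is well defined and the $T_{\mathbb{O}}$ form a basis. The class polynomials $f_{\tilde w,\mathbb{O}}$ are the unique coefficients with $T_{\tilde w}\equiv\sum_{\mathbb{O}}f_{\tilde w,\mathbb{O}}T_{\mathbb{O}}\bmod[\widetilde H,\widetilde H]$. Conjugacy classes of $\widetilde W$ in $W_a\tau$: for $\lambda\in P_+\cap Q$ not of the form $2m\alpha_1+m\alpha_2$ ($m\geq0$), $\mathbb{O}_{\lambda,\tau}$ is the class of $t^\lambda s_2s_1\tau$; for $i\in\mathbb{Z}$, $\mathbb{O}_{i,\tau}=\{t^{k\alpha_1+i\alpha_2}s_1s_2s_1\tau,\ t^{(k+i-1)\alpha_1+k\alpha_2}s_2\tau,\ t^{(1-i)\alpha_1+k\alpha_2}s_1\tau\mid k\in\mathbb{Z}\}$. $Q_{sh}=Q\setminus\{k(\alpha_1+2\alpha_2),k(2\alpha_1+\alpha_2),k(\alpha_1-\alpha_2)\mid k\in\mathbb{Z}\}$. For $\lambda=m\alpha_1+n\alpha_2\in P_+\cap Q_{sh}$, $E_{m\alpha_1+n\alpha_2,\tau}=\{k\alpha_1+n\alpha_2\mid\lfloor\frac n2\rfloor+1\leq k\leq m-1\}$ and $E'_{m\alpha_1+n\alpha_2,\tau}=\{m\alpha_1+k\alpha_2\mid\lfloor\frac{m+1}2\rfloor+1\leq k\leq n\}$. *)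

(* Defs.v *)
From HB Require Import structures.
From mathcomp Require Import all_boot all_order all_algebra fingroup perm ring.
From mathcomp Require Import fraction.
From mathcomp Require Import boolp classical_sets functions cardinality fsbigop.

Set Implicit Arguments.
Unset Strict Implicit.
Unset Printing Implicit Defensive.

Import Order.TTheory GRing.Theory Num.Theory.
Local Open Scope classical_set_scope.
Local Open Scope ring_scope.

(* Z[v, v^-1] as the subring {p / X^n} of the field of fractions of Z[X],
   with v = X. *)
Definition laurent_pred (x : {fraction {poly int}}) : bool :=
  `[< exists (p : {poly int}) (n : nat), x = tofrac p / tofrac 'X ^+ n >].

Lemma fracX_neq0 : tofrac ('X : {poly int}) != 0 :> {fraction {poly int}}.
Proof. by rewrite tofrac_eq0 polyX_eq0. Qed.

Lemma laurent_subring : subring_closed laurent_pred.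
Proof.
split.
- by apply/asboolP; exists 1, 0; rewrite expr0 divr1 rmorph1.
- move=> _ _ /asboolP[p [n ->]] /asboolP[q [m ->]]; apply/asboolP.
  exists (p * 'X^m - q * 'X^n), (n + m)%N.
  rewrite rmorphB !rmorphM !rmorphXn /= exprD invfM mulrBl.
  congr (_ - _).
    by rewrite mulrACA divff ?mulr1 // expf_neq0 // fracX_neq0.
  by rewrite [X in _ = _ * X]mulrC mulrACA divff ?mulr1 // expf_neq0 // fracX_neq0.
- move=> _ _ /asboolP[p [n ->]] /asboolP[q [m ->]]; apply/asboolP.
  by exists (p * q), (n + m)%N; rewrite rmorphM exprD invfM mulrACA.
Qed.

HB.instance Definition _ :=
  GRing.isSubringClosed.Build {fraction {poly int}} laurent_pred laurent_subring.

Record laurent := Laurent {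
  laurent_val :> {fraction {poly int}};
  _ : laurent_val \in laurent_pred }.

HB.instance Definition _ := [isSub for laurent_val].
HB.instance Definition _ := [Choice of laurent by <:].
HB.instance Definition _ := [SubChoice_isSubComNzRing of laurent by <:].

Lemma v_subproof : tofrac ('X : {poly int}) \in laurent_pred.
Proof. by apply/asboolP; exists 'X, 0; rewrite expr0 divr1. Qed.

Lemma vinv_subproof : (tofrac ('X : {poly int}))^-1 \in laurent_pred.
Proof. by apply/asboolP; exists 1, 1%N; rewrite rmorph1 mul1r expr1. Qed.

Definition v : laurent := Laurent v_subproof.
Definition vinv : laurent := Laurent vinv_subproof.

Lemma v_vinv : v * vinv = 1.
Proof. by apply: val_inj; rewrite /= divff // fracX_neq0. Qed.

(* The coweight lattice P in the basis of fundamental coweights, i.e.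
   l = (<l, alpha1>, <l, alpha2>). *)
Definition P : Type := (int * int)%type.
HB.instance Definition _ := GRing.Zmodule.on P.

Definition alpha1 : P := (2, -1).
Definition alpha2 : P := (-1, 2).

(* W is realised as 'S_3 acting on P = Z^3 / Z(1,1,1) by permuting coordinates;
   (l.1 + l.2, l.2, 0) is the representative of l with last coordinate 0. *)
Definition coord (l : P) (i : 'I_3) : int := [:: l.1 + l.2; l.2; 0]`_i.

Definition act (w : 'S_3) (l : P) : P :=
  (coord l (w 0) - coord l (w 1), coord l (w 1) - coord l (w 2)).

Lemma ord3P (i : 'I_3) : [\/ i = 0, i = 1 | i = 2].
Proof.
by case: i => [[|[|[|//]]] ?]; [constructor 1|constructor 2|constructor 3];
   exact: val_inj.
Qed.

Lemma coord_act w l i : coord (act w l) i = coord l (w i) - coord l (w 2).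
Proof.
case: (ord3P i) => ->; rewrite /coord /=.
- by rewrite addrA subrK.
- by [].
- by rewrite subrr.
Qed.

Lemma actM w u l : act (w * u)%g l = act w (act u l).
Proof.
by rewrite /act -/(act u l) !coord_act !permM; congr pair;
   rewrite opprB addrA subrK.
Qed.

Lemma act1 l : act 1%g l = l.
Proof. by case: l => a b; rewrite /act !perm1 /coord /= addrK subr0. Qed.

Lemma actD w l m : act w (l + m) = act w l + act w m.
Proof.
have coordD i : coord (l + m) i = coord l i + coord m i.
  by case: (ord3P i) => ->; rewrite /coord //= addrACA.
by rewrite /act !coordD; congr pair; rewrite opprD addrACA.
Qed.

Lemma act0 w : act w 0 = 0.
Proof. by apply: (addrI (act w 0)); rewrite -actD !addr0. Qed.

Lemma actN w l : act w (- l) = - act w l.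
Proof.
by apply: (addrI (act w l)); rewrite -actD !subrr act0.
Qed.

(* Extended affine Weyl group P ><| W; EAW l w is t^l w. *)
Record eaw := EAW { eaw_trans : P; eaw_fin : 'S_3 }.

Definition pair_of_eaw (x : eaw) : P * 'S_3 := (eaw_trans x, eaw_fin x).
Definition eaw_of_pair (x : P * 'S_3) : eaw := EAW x.1 x.2.
Lemma pair_of_eawK : cancel pair_of_eaw eaw_of_pair. Proof. by case. Qed.
HB.instance Definition _ := Equality.copy eaw (can_type pair_of_eawK).
HB.instance Definition _ := Choice.copy eaw (can_type pair_of_eawK).

Definition eaw_mul (x y : eaw) : eaw :=
  EAW (eaw_trans x + act (eaw_fin x) (eaw_trans y)) (eaw_fin x * eaw_fin y)%g.
Definition eaw_one : eaw := EAW 0 1%g.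
Definition eaw_inv (x : eaw) : eaw :=
  EAW (- act (eaw_fin x)^-1%g (eaw_trans x)) (eaw_fin x)^-1%g.

Lemma eaw_mulA : associative eaw_mul.
Proof.
by move=> x y z; rewrite /eaw_mul /= actD actM addrA mulgA.
Qed.
Lemma eaw_mul1 : left_id eaw_one eaw_mul.
Proof. by case=> l w; rewrite /eaw_mul /= act1 add0r mul1g. Qed.
Lemma eaw_mulV : left_inverse eaw_one eaw_inv eaw_mul.
Proof. by case=> l w; rewrite /eaw_mul /= mulVg addNr. Qed.
Lemma eaw_mulr1 : right_id eaw_one eaw_mul.
Proof. by case=> l w; rewrite /eaw_mul /= act0 addr0 mulg1. Qed.
Lemma eaw_mulrV : right_inverse eaw_one eaw_inv eaw_mul.
Proof. by case=> l w; rewrite /eaw_mul /= actN -actM mulgV act1 subrr. Qed.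

HB.instance Definition _ :=
  isGroup.Build eaw eaw_mulA eaw_mul1 eaw_mulr1 eaw_mulV eaw_mulrV.

Definition t (l : P) : eaw := EAW l 1%g.
Definition s1 : eaw := EAW 0 (tperm 0 1).
Definition s2 : eaw := EAW 0 (tperm 1 2).
Definition s0 : eaw := (t (alpha1 + alpha2) * s1 * s2 * s1)%g.
Definition omega1 : P := (1, 0).
Definition tau : eaw := (t omega1 * s1 * s2)%g.

Lemma omega1E : omega1 *+ 3 = alpha1 *+ 2 + alpha2.
Proof. by []. Qed.

Lemma mulrz_pair (l : P) (k : int) : l *~ k = (l.1 * k, l.2 * k).
Proof.
case: l => a b; rewrite -(mulrzz a) -(mulrzz b).
have pairn n : (a, b) *+ n = (a *+ n, b *+ n).
  by elim: n => [//|n IH]; rewrite !mulrS IH.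
case: k => n; first by rewrite -!pmulrn; exact: pairn.
by rewrite NegzE !mulrNz -!pmulrn pairn.
Qed.

Lemma s1E l : act (eaw_fin s1) l = l - alpha1 *~ l.1.
Proof.
case: l => a b; rewrite mulrz_pair /act /= tpermL tpermR tpermD //.
rewrite -[RHS]/(a - 2 * a, b - -1 * a) /coord /=; congr pair; ring.
Qed.

Lemma s2E l : act (eaw_fin s2) l = l - alpha2 *~ l.2.
Proof.
case: l => a b; rewrite mulrz_pair /act /= tpermL tpermR tpermD //.
rewrite -[RHS]/(a - -1 * b, b - 2 * b) /coord /=; congr pair; ring.
Qed.

Lemma eaw_eqP (x y : eaw) : eaw_trans x = eaw_trans y ->
  (forall i, eaw_fin x i = eaw_fin y i) -> x = y.
Proof. by case: x y => [l w] [m u] /= -> /permP->. Qed.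

Lemma eaw_transM x y :
  eaw_trans (x * y)%g = eaw_trans x + act (eaw_fin x) (eaw_trans y).
Proof. by []. Qed.

Lemma eaw_finM x y : eaw_fin (x * y)%g = (eaw_fin x * eaw_fin y)%g.
Proof. by []. Qed.

Lemma tM l m : t (l + m) = (t l * t m)%g.
Proof. by apply: eaw_eqP => [|i]; rewrite ?eaw_finM /= ?act1 ?mulg1. Qed.

Lemma s1_fin :
  (eaw_fin s1 0 = 1) * (eaw_fin s1 1 = 0) * (eaw_fin s1 2 = 2).
Proof. by rewrite /= tpermL tpermR tpermD. Qed.

Lemma s2_fin :
  (eaw_fin s2 0 = 0) * (eaw_fin s2 1 = 2) * (eaw_fin s2 2 = 1).
Proof. by rewrite /= tpermL tpermR tpermD. Qed.

Ltac eaw_compute := rewrite ?/s0 ?/tau; apply: eaw_eqP;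
  [ by rewrite !(eaw_transM, eaw_finM, actM, act1, act0, s1E, s2E)
  | let i := fresh "i" in move=> i; case: (ord3P i) => ->;
    by rewrite !(eaw_finM, permM, s1_fin, s2_fin, perm1) ].

Lemma s1K : (s1 * s1 = 1)%g. Proof. eaw_compute. Qed.
Lemma s2K : (s2 * s2 = 1)%g. Proof. eaw_compute. Qed.
Lemma tau3 : (tau * tau * tau = 1)%g. Proof. eaw_compute. Qed.
Lemma tau_s0 : (tau * s0 = s1 * tau)%g. Proof. eaw_compute. Qed.
Lemma tau_s1 : (tau * s1 = s2 * tau)%g. Proof. eaw_compute. Qed.
Lemma tau_s2 : (tau * s2 = s0 * tau)%g. Proof. eaw_compute. Qed.

Definition simple_refl : seq eaw := [:: s0; s1; s2].

Definition has_word (x : eaw) (n : nat) : Prop :=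
  exists (l : seq eaw) (j : nat),
    [/\ size l = n, all (mem simple_refl) l
      & x = (\prod_(s <- l) s * tau ^+ j)%g].

Definition generated (x : eaw) : Prop := exists n, has_word x n.

Lemma generated1 : generated 1%g.
Proof. by exists 0, [::], 0; split; rewrite // big_nil mulg1. Qed.

Lemma generated_refl s x :
  s \in simple_refl -> generated x -> generated (s * x)%g.
Proof.
move=> ss [n [l [j [_ al ->]]]]; exists (size l).+1, (s :: l), j.
by split => //=; [apply/andP|rewrite big_cons mulgA].
Qed.

Lemma generated_tau x : generated x -> generated (tau * x)%g.
Proof.
move=> [n [l [j [_ al ->]]]]; elim: l al => [_|s l IH /= /andP[ss al]].
  by exists 0, [::], j.+1; split; rewrite // !big_nil !mul1g expgS.
rewrite big_cons -(mulgA s); move: (IH al) => Gl.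
have {}ss : s \in [:: s0; s1; s2] by [].
have [s0s s1s s2s] : [/\ s0 \in simple_refl, s1 \in simple_refl
  & s2 \in simple_refl] by split; rewrite /simple_refl !inE eqxx ?orbT.
move: ss; rewrite !inE => /or3P[] /eqP -> /=;
  rewrite (mulgA tau) ?tau_s0 ?tau_s1 ?tau_s2 -(mulgA _ tau);
  exact: generated_refl.
Qed.

Definition gen_stable (a : eaw) : Prop :=
  forall x, generated x -> generated (a * x)%g.

Lemma gen_stableM a b : gen_stable a -> gen_stable b -> gen_stable (a * b)%g.
Proof. by move=> Ga Gb x Gx; rewrite -(mulgA a); apply/Ga/Gb. Qed.

Lemma gen_stable_s0 : gen_stable s0.
Proof. by move=> x; apply: generated_refl; rewrite /simple_refl !inE eqxx. Qed.

Lemma gen_stable_s1 : gen_stable s1.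
Proof. by move=> x; apply: generated_refl; rewrite /simple_refl !inE eqxx orbT. Qed.

Lemma gen_stable_s2 : gen_stable s2.
Proof. by move=> x; apply: generated_refl; rewrite /simple_refl !inE eqxx !orbT. Qed.

Lemma tperm02 : EAW 0 (tperm 0 2) = (s1 * s2 * s1)%g.
Proof.
apply: eaw_eqP => [|i]; first by rewrite !(eaw_transM, act0).
by case: (ord3P i) => ->;
  rewrite !(eaw_finM, permM, s1_fin, s2_fin) /= ?tpermL ?tpermR ?tpermD.
Qed.

Lemma gen_stable_tperm i k : gen_stable (EAW 0 (tperm i k)).
Proof.
have G1 : gen_stable (EAW 0 1%g).
  by move=> x Gx; rewrite [(_ * _)%g](@mul1g eaw).
have G02 : gen_stable (EAW 0 (tperm 0 2)).
  rewrite tperm02; apply: gen_stableM gen_stable_s1.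
  exact: gen_stableM gen_stable_s1 gen_stable_s2.
case: (ord3P i) => ->; case: (ord3P k) => ->; rewrite ?tperm1 //;
  try exact: gen_stable_s1; try exact: gen_stable_s2; rewrite tpermC //;
  by [apply: gen_stable_s1 | apply: gen_stable_s2].
Qed.

Lemma gen_stable_fin w : gen_stable (EAW 0 w).
Proof.
case: (prod_tpermP w) => ts -> _.
elim: ts => [|p ts IH].
  by rewrite big_nil => x Gx; rewrite [(_ * _)%g](@mul1g eaw).
rewrite big_cons.
have -> : EAW 0 (tperm p.1 p.2 * \prod_(q <- ts) tperm q.1 q.2)%g =
    (EAW 0 (tperm p.1 p.2) * EAW 0 (\prod_(q <- ts) tperm q.1 q.2)%g)%g.
  by apply: eaw_eqP => //; rewrite eaw_transM act0.
exact: gen_stableM (gen_stable_tperm _ _) IH.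
Qed.

Lemma gen_stable_t l : gen_stable (t l).
Proof.
have Gs0 := gen_stable_s0; have Gs1 := gen_stable_s1; have Gs2 := gen_stable_s2.
have Gtau : gen_stable tau by exact: generated_tau.
have G3 a b c : gen_stable a -> gen_stable b -> gen_stable c ->
  gen_stable (a * b * c)%g.
  by move=> Ga Gb Gc; apply: gen_stableM Gc; apply: gen_stableM.
have tau_t : (tau * s2 * s1 = t omega1)%g by eaw_compute.
have tau_tN : (s1 * s2 * tau * tau = t (- omega1))%g by eaw_compute.
have th_t : (tau * tau * s1 * s2 = t (alpha1 + alpha2 - omega1))%g.
  by eaw_compute.
have th_tN : (s2 * s1 * tau = t (omega1 - (alpha1 + alpha2)))%g.
  by eaw_compute.
have Gzmul u : gen_stable (t u) -> gen_stable (t (- u)) ->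
    forall k : int, gen_stable (t (u *~ k)).
  move=> Gu GuN k.
  have G0 : gen_stable (t 0) by move=> x; rewrite [(_ * x)%g](@mul1g eaw).
  have Gn z n : gen_stable (t z) -> gen_stable (t (z *+ n)).
    by move=> Gz; elim: n => [//|n IH]; rewrite mulrS tM; apply: gen_stableM.
  case: k => n; first by rewrite -pmulrn; apply: Gn.
  by rewrite NegzE mulrNz -pmulrn -mulNrn; apply: Gn.
have -> : l = omega1 *~ l.1 + (alpha1 + alpha2 - omega1) *~ l.2.
  case: l => a b; rewrite !mulrz_pair.
  rewrite -[RHS]/(1 * a + (2 - 1 - 1) * b, 0 * a + (- 1 + 2 - 0) * b).
  by congr pair; ring.
rewrite tM; apply: gen_stableM; apply: Gzmul.
- by rewrite -tau_t; apply: G3.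
- by rewrite -tau_tN; apply: gen_stableM => //; apply: G3.
- by rewrite -th_t; apply: gen_stableM => //; apply: G3.
- by rewrite opprB -th_tN; apply: G3.
Qed.

Lemma generatedP x : generated x.
Proof.
case: x => l w.
have -> : EAW l w = (t l * (EAW 0 w * 1))%g.
  apply: eaw_eqP => [|i]; last by rewrite !eaw_finM mul1g mulg1.
  by rewrite !eaw_transM !act0 !addr0.
exact/gen_stable_t/gen_stable_fin/generated1.
Qed.

(* Every element is w * tau^j with w in W_a, and the length of w tau^j is the
   Coxeter length of w, so a minimum over all j is the length. *)
Lemma ex_has_word x : exists n, `[< has_word x n >].
Proof. by have [n xn] := generatedP x; exists n; apply/asboolP. Qed.

Definition ell (x : eaw) : nat := ex_minn (ex_has_word x).

Record is_hecke_basis (H : algType laurent) (T : eaw -> H) : Prop := {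
  hecke_span : forall h : H, exists (r : seq eaw) (c : eaw -> laurent),
    h = \sum_(x <- r) c x *: T x;
  hecke_free : forall (r : seq eaw) (c : eaw -> laurent), uniq r ->
    \sum_(x <- r) c x *: T x = 0 -> {in r, forall x, c x = 0};
  hecke_mul : forall x y : eaw, ell (x * y)%g = (ell x + ell y)%N ->
    T x * T y = T (x * y)%g;
  hecke_quad : {in simple_refl, forall s, (T s - v%:A) * (T s + vinv%:A) = 0}
}.

(* [H, H], the span over Z[v, v^-1] of the commutators. *)
Definition commutators (H : algType laurent) : set H :=
  [set h | exists r : seq (laurent * (H * H)),
     h = \sum_(p <- r) p.1 *: (p.2.1 * p.2.2 - p.2.2 * p.2.1)].

Definition conj_class (x : eaw) : set eaw := [set (y * x * y^-1)%g | y in setT].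

Definition conj_classes : set (set eaw) := range conj_class.

Definition min_length (O : set eaw) (x : eaw) : Prop :=
  O x /\ forall y, O y -> (ell x <= ell y)%N.

(* f O is the coefficient of T_O, where T_O is the class of T (rep O) for any
   choice rep of minimal length representatives; only the values of f at
   conjugacy classes matter, and only finitely many of them are nonzero. *)
Definition is_class_polynomials (H : algType laurent) (T : eaw -> H) (w : eaw)
    (f : set eaw -> laurent) : Prop :=
  finite_set (conj_classes `&` [set O | f O <> 0]) /\
  forall rep : set eaw -> eaw,
    (forall O, conj_classes O -> min_length O (rep O)) ->
    commutators (T w - \sum_(O \in conj_classes) f O *: T (rep O)).

Definition qvec (m n : int) : P := alpha1 *~ m + alpha2 *~ n.

Definition Qlat : set P := [set l | exists m n : int, l = qvec m n].

Definition Pplus : set P := [set l | 0 <= l.1 /\ 0 <= l.2].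

Definition Qsh : set P :=
  Qlat `\` [set l | exists k : int,
    [\/ l = (alpha1 + alpha2 *+ 2) *~ k, l = (alpha1 *+ 2 + alpha2) *~ k
      | l = (alpha1 - alpha2) *~ k]].

Definition Olam_tau (l : P) : set eaw := conj_class (t l * s2 * s1 * tau)%g.

Definition Oint_tau (i : int) : set eaw :=
  [set x | exists k : int,
    [\/ x = (t (qvec k i) * s1 * s2 * s1 * tau)%g,
        x = (t (qvec (k + i - 1) k) * s2 * tau)%g
      | x = (t (qvec (1 - i) k) * s1 * tau)%g]].

Definition E_tau (m n : int) : set P :=
  [set qvec k n | k in [set k : int | (n %/ 2)%Z + 1 <= k <= m - 1]].

Definition E'_tau (m n : int) : set P :=
  [set qvec m k | k in [set k : int | ((m + 1) %/ 2)%Z + 1 <= k <= n]].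

(* Main.v *)
(** Left multiplication by [s_i] acts on the window of an affine permutation by
    exchanging entries, so lengths and descents are linear conditions on window
    differences.  Any operators satisfying the braid and rotation relations then
    extend to the whole group, and the traces of the resulting Hecke modules
    vanish on commutators.

    Uniqueness.  We use the modules spanned by words (a, b, c) of labels, with
    [T_s] acting on adjacent letters and [tau] by a weighted rotation.  At v = 1
    their traces are characters of the extended affine Weyl group: labels 0,1,2
    separate the translation classes, labels 0,0,1 the reflection classes and
    labels 0,0,0 the elliptic ones.  Hence the coefficients of a relation between
    the T_O all vanish at v = 1, and dividing by v - 1 repeatedly shows that they
    are zero.

    Existence.  Conjugating [t^(k alpha1 + i alpha2) s1 s2 s1 tau] by [tau s2]
    replaces k by i + 1 - k without changing the length; conjugating then by [s1]
    shortens it, replaces i + 1 - k by k - 1, and produces (v - v^-1) times the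
    translation [t^((k-1) alpha1 + i alpha2) s2 s1 tau].  Iterating down to
    k = floor(i/2) + 1 reaches a minimal length element. *)

From HB Require Import structures.
From mathcomp Require Import all_boot all_order all_algebra fingroup perm.
From mathcomp Require Import boolp classical_sets functions cardinality fsbigop.
From mathcomp Require Import algC cyclotomic zify ring.
Require Import Defs.

Set Implicit Arguments.
Unset Strict Implicit.
Unset Printing Implicit Defensive.

Import Order.TTheory GRing.Theory Num.Theory.
Local Open Scope classical_set_scope.
Local Open Scope ring_scope.

(** * Window coordinates and length *)

Lemma coordD (l m : P) i : coord (l + m) i = coord l i + coord m i.
Proof. by case: (ord3P i) => ->; rewrite /coord //= addrACA. Qed.

Lemma coord_inj (l m : P) :
  (forall i j, coord l i - coord l j = coord m i - coord m j) -> l = m.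
Proof.
case: l m => [a b] [c e] h; have := h 0 1; have := h 1 2.
by rewrite /coord /= !subr0 !addrK => -> ->.
Qed.

Lemma permS3_eq (w u : 'S_3) : w 0 = u 0 -> w 1 = u 1 -> w 2 = u 2 -> w = u.
Proof. by move=> h0 h1 h2; apply/permP => i; case: (ord3P i) => ->. Qed.

(* The window of x as an affine permutation, defined up to a common shift by a
   multiple of 3; only differences of entries matter. *)
Definition win (x : eaw) (i : 'I_3) : int :=
  3 * coord (eaw_trans x) i - (eaw_fin x i : nat)%:Z.

(** [coord_act] normalises the last coordinate to zero and so adds one constant to all entries. It
    cancels in differences, which are then permuted by [eaw_fin u] and shifted. *)
Lemma win_mul u x i j : win (u * x)%g i - win (u * x)%g j =
  3 * (coord (eaw_trans u) i - coord (eaw_trans u) j) +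
  (win x (eaw_fin u i) - win x (eaw_fin u j)).
Proof.
rewrite /win eaw_transM eaw_finM !permM !coordD !coord_act.
ring.
Qed.

(* The pairing of x with the i-th affine simple root; refl i is a left descent of
   x if and only if dwin i x < 0. *)
Definition dwin (i : 'I_3) (x : eaw) : int :=
  [:: win x 2 - win x 0 + 3; win x 0 - win x 1; win x 1 - win x 2]`_i.

Definition refl (i : 'I_3) : eaw := nth s0 [:: s0; s1; s2] i.

Lemma tau_fin :
  (eaw_fin tau 0 = 2) * (eaw_fin tau 1 = 0) * (eaw_fin tau 2 = 1).
Proof. by rewrite !(eaw_finM, permM, s1_fin, s2_fin, perm1). Qed.

Lemma s0_fin :
  (eaw_fin s0 0 = 2) * (eaw_fin s0 1 = 1) * (eaw_fin s0 2 = 0).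
Proof. by rewrite !(eaw_finM, permM, s1_fin, s2_fin, perm1). Qed.

Lemma tau_trans : eaw_trans tau = omega1.
Proof. by rewrite !(eaw_transM, act0, addr0). Qed.

Lemma s0_trans : eaw_trans s0 = alpha1 + alpha2.
Proof. by rewrite !(eaw_transM, act0, addr0). Qed.

Lemma ord3S : (0 + 1 = 1 :> 'I_3) * (1 + 1 = 2 :> 'I_3) *
  (2 + 1 = 0 :> 'I_3) * (0 + 2 = 2 :> 'I_3) * (1 + 2 = 0 :> 'I_3) *
  (2 + 2 = 1 :> 'I_3).
Proof. by do !split; apply: val_inj. Qed.


Lemma dwin_refl i x : [/\ dwin i (refl i * x)%g = - dwin i x,
  dwin (i + 1) (refl i * x)%g = dwin (i + 1) x + dwin i x &
  dwin (i + 2) (refl i * x)%g = dwin (i + 2) x + dwin i x].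
Proof.
by case: (ord3P i) => ->; rewrite ?ord3S /dwin /refl /= !win_mul
   ?s0_fin ?s1_fin ?s2_fin ?s0_trans /coord /=; split; ring.
Qed.

Lemma dwin_tau i x : dwin (i + 1) (tau * x)%g = dwin i x.
Proof.
by case: (ord3P i) => ->; rewrite ?ord3S /dwin /refl /= !win_mul
   !tau_fin ?tau_trans /coord /=; ring.
Qed.

Lemma dwin_sum x : dwin 0 x + dwin 1 x + dwin 2 x = 3.
Proof. rewrite /dwin /=; ring. Qed.

(** The entries of a window are distinct modulo 3, since their residues come from a permutation. In
    particular no pairing vanishes, so each [refl i] strictly raises or lowers the length. *)
Lemma dwin_mod3 i x : (dwin i x %% 3)%Z != 0.
Proof.
have aux (a b : int) (p q : nat) : (p < 3)%N -> (q < 3)%N -> p <> q ->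
    ((3 * a - p%:Z - (3 * b - q%:Z)) %% 3)%Z != 0 by lia.
have neq k l : k != l -> (eaw_fin x k : nat) <> eaw_fin x l.
  by move=> /eqP kl /val_inj/perm_inj.
by case: (ord3P i) => ->; rewrite /dwin /win /= ?modzDr; apply: aux => //;
  apply: neq.
Qed.

(** Shi's inversion formula for affine permutations: each absolute value counts the inversions in
    the direction of one positive root. *)
Definition len (x : eaw) : nat :=
  (`|(dwin 0%R x %/ 3)%Z| + `|(dwin 1%R x %/ 3)%Z| + `|(dwin 2%R x %/ 3)%Z|)%N.

(** Because the three pairings sum to 3 and are not divisible by 3, [refl i] only interchanges the
    two other terms. In the i-th term the floor q becomes -q-1, which changes its absolute value by
    one. *)
Lemma len_refl i x :
  len (refl i * x)%g = if dwin i x < 0 then (len x).-1 else (len x).+1.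
Proof.
have [e0 e1 e2] := dwin_refl i x.
have := dwin_mod3 0 x; have := dwin_mod3 1 x; have := dwin_mod3 2 x.
have := dwin_sum x; move: e0 e1 e2.
case: (ord3P i) => ->; rewrite ?ord3S /len => -> -> ->; 
 case: ifP => h *; lia.
Qed.

Lemma len_desc i x : dwin i x < 0 -> len x = (len (refl i * x)%g).+1.
Proof.
move=> h; rewrite len_refl h prednK //.
have := dwin_mod3 i x; have := dwin_sum x; move: h; rewrite /len.
by case: (ord3P i) => ->; lia.
Qed.

Lemma len_tau x : len (tau * x)%g = len x.
Proof.
have := dwin_tau 0 x; have := dwin_tau 1 x; have := dwin_tau 2 x.
by rewrite ?ord3S /len => -> -> ->; lia.
Qed.

Lemma dwin1 i : dwin i 1%g = 1.
Proof.
have e0 : eaw_fin 1%g = 1%g by [].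
have t0 : eaw_trans 1%g = 0 by [].
by case: (ord3P i) => ->; rewrite /dwin /win e0 t0 !perm1.
Qed.

Lemma len1 : len 1%g = 0%N.
Proof. by rewrite /len !dwin1. Qed.

Lemma desc_exists x : (0 < len x)%N -> exists i, dwin i x < 0.
Proof.
move=> h; case: (ltP (dwin 0 x) 0) => h0; first by exists 0.
case: (ltP (dwin 1 x) 0) => h1; first by exists 1.
exists 2; move: h h0 h1; rewrite /len; have := dwin_sum x.
have := dwin_mod3 0 x; have := dwin_mod3 1 x; have := dwin_mod3 2 x.
lia.
Qed.

(** At length zero the pairings are positive and sum to 3, so all equal 1. The window then consists
    of consecutive integers, and only its residue is free. *)
Lemma len0 x : len x = 0%N -> x = (tau ^+ (2 - eaw_fin x 2%R)%N)%g.
Proof.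
move=> h; have {h}[h1 h2] : win x 0 - win x 1 = 1 /\ win x 1 - win x 2 = 1.
  move: h; rewrite /len; have := dwin_sum x.
  have := dwin_mod3 0 x; have := dwin_mod3 1 x; have := dwin_mod3 2 x.
  by rewrite /dwin /=; split; lia.
(* A decreasing run of consecutive entries leaves three windows, one for each residue [r]; they are
   those of the powers of [tau]. *)
have aux (a b : int) (p q r : nat) : (p < 3)%N -> (q < 3)%N -> (r < 3)%N ->
    3 * (a + b) - p%:Z - (3 * b - q%:Z) = 1 ->
    3 * b - q%:Z - (3 * 0 - r%:Z) = 1 ->
    [\/ [/\ r = 0, q = 2 & p = 1]%N /\ (a, b) = (0, 1) :> P,
       [/\ r = 1, q = 0 & p = 2]%N /\ (a, b) = (1, 0) :> P |
       [/\ r = 2, q = 1 & p = 0]%N /\ (a, b) = (0, 0) :> P].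
  move=> p3 q3 r3 e1 e2.
  have : (r = 0 \/ r = 1 \/ r = 2)%N by lia.
  by case=> [|[]] er; [constructor 1|constructor 2|constructor 3];
    split; [split| |split| |split|]; try lia; congr pair; lia.
case: x h1 h2 => [[a b] w] /= h1 h2.
have /= := aux _ _ _ _ _ (ltn_ord _) (ltn_ord _) (ltn_ord _) h1 h2.
case=> -[[e2 e1 e0] ->]; rewrite e2;
  rewrite -?[(2 - 0)%N]/2%N -?[(2 - 1)%N]/1%N -?[(2 - 2)%N]/0%N;
  apply: eaw_eqP => [|i].
- by rewrite expgS expg1 eaw_transM tau_trans /act !tau_fin.
- rewrite expgS expg1 eaw_finM permM /=; apply: val_inj.
  by case: (ord3P i) => ->; rewrite !tau_fin /= ?e0 ?e1 ?e2.
- by rewrite expg1 tau_trans.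
- rewrite expg1 /=; apply: val_inj.
  by case: (ord3P i) => ->; rewrite !tau_fin /= ?e0 ?e1 ?e2.
- by [].
- rewrite expg0 /=; apply: val_inj.
  by case: (ord3P i) => ->; rewrite perm1 /= ?e0 ?e1 ?e2.
Qed.

Lemma refl_simple i : refl i \in simple_refl.
Proof. by case: (ord3P i) => ->; rewrite !inE eqxx ?orbT. Qed.

Lemma simple_reflP s : s \in simple_refl -> exists i, s = refl i.
Proof.
by rewrite !inE => /or3P[] /eqP->; [exists 0|exists 1|exists 2].
Qed.

Lemma s0K : (s0 * s0 = 1)%g. Proof. eaw_compute. Qed.

Lemma reflK i : (refl i * refl i = 1)%g.
Proof.
by case: (ord3P i) => ->; [exact: s0K | exact: s1K | exact: s2K].
Qed.

Lemma reflKx i x : (refl i * (refl i * x) = x)%g.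
Proof. by rewrite mulgA reflK mul1g. Qed.

Lemma refl_tau i : (tau * refl i = refl (i + 1) * tau)%g.
Proof.
by case: (ord3P i) => ->; rewrite ?ord3S;
   [exact: tau_s0 | exact: tau_s1 | exact: tau_s2].
Qed.

Lemma len_tauX j x : len (tau ^+ j * x)%g = len x.
Proof. by elim: j => [|j IH]; rewrite ?mul1g // expgS -mulgA len_tau. Qed.

(** Stripping left descents one at a time ends at a power of [tau], by [len0]. *)
Lemma has_word_len x : has_word x (len x).
Proof.
elim: (len x) {-2}x (erefl (len x)) => {x} [|n IH] x hx.
  by exists [::], (2 - eaw_fin x 2%R)%N; split; rewrite // big_nil mul1g -len0.
have [|i hi] := @desc_exists x; first by rewrite hx.
have [|l [j [sl al e]]] := IH (refl i * x)%g.
  by have := len_desc hi; rewrite hx => -[].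
exists (refl i :: l), j; split.
- by rewrite /= sl -len_desc.
- by rewrite /= al andbT; exact: refl_simple.
- by rewrite big_cons -mulgA -e reflKx.
Qed.

Lemma has_word_ge x n : has_word x n -> (len x <= n)%N.
Proof.
move=> [l [j [<- al ->]]]; elim: l al => [_|s l IH /= /andP[ss al]].
  by rewrite big_nil mul1g -(mulg1 (tau ^+ j)%g) len_tauX len1.
have [i ->] := simple_reflP ss.
rewrite big_cons -mulgA len_refl; move: (IH al) => {}IH; case: ifP => _.
  by apply: leq_trans (leq_pred _) _; apply: leqW.
by rewrite ltnS.
Qed.

Lemma ellE x : ell x = len x.
Proof.
rewrite /ell; case: ex_minnP => n /asboolP /has_word_ge h1 h2.
by apply/eqP; rewrite eqn_leq h1 andbT; apply: h2; apply/asboolP/has_word_len.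
Qed.

(** * Operators satisfying the braid relations *)

Lemma braid_refl i :
  (refl i * (refl (i + 1) * refl i) = refl (i + 1) * (refl i * refl (i + 1)))%g.
Proof. by case: (ord3P i) => ->; rewrite ?ord3S /refl /=; eaw_compute. Qed.

Lemma dwin_refl_next i x :
  dwin (i + 1) (refl i * x)%g = dwin (i + 1) x + dwin i x.
Proof. by case: (dwin_refl i x). Qed.

Lemma dwin_refl_prev i x :
  dwin i (refl (i + 1) * x)%g = dwin i x + dwin (i + 1) x.
Proof.
by case: (dwin_refl (i + 1) x) => _ _; case: (ord3P i) => ->; rewrite ?ord3S.
Qed.

Lemma dwin_refl_self i x : dwin i (refl i * x)%g = - dwin i x.
Proof. by case: (dwin_refl i x). Qed.

Lemma ord3_neq (i j : 'I_3) : [\/ i = j, j = i + 1 | i = j + 1].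
Proof.
case: (ord3P i) => ->; case: (ord3P j) => ->; rewrite ?ord3S;
  by [constructor 1 | constructor 2 | constructor 3].
Qed.

Lemma tau_finM x i : eaw_fin (tau * x)%g i = eaw_fin x (eaw_fin tau i).
Proof. exact: permM. Qed.

(** On an element of length zero this is the exponent j among 0, 1, 2 with [x = tau ^+ j]; see
    [len0]. *)
Definition tau_exp (x : eaw) : nat := (2 - eaw_fin x 2%R)%N.

Lemma tau_exp_tau x : len x = 0%N ->
  tau_exp (tau * x)%g = if tau_exp x == 2 then 0%N else (tau_exp x).+1.
Proof.
move=> /len0 ->; rewrite /tau_exp.
move: (leq_ord (eaw_fin x 2)); case: (nat_of_ord _) => [|[|[|//]]] _.
- by rewrite -[(2 - 0)%N]/2%N expgS expg1 !tau_finM !tau_fin.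
- by rewrite -[(2 - 1)%N]/1%N expg1 !tau_finM !tau_fin.
- by rewrite -[(2 - 2)%N]/0%N expg0 mulg1 !tau_fin perm1.
Qed.

Section Matsumoto.

Variables (V : Type) (A : 'I_3 -> V -> V) (U : V -> V).
Hypothesis UA : forall i f, U (A i f) = A (i + 1) (U f).
Hypothesis U3 : forall f, U (U (U f)) = f.
Hypothesis braid : forall i f,
  A i (A (i + 1) (A i f)) = A (i + 1) (A i (A (i + 1) f)).

Definition descent (x : eaw) : 'I_3 :=
  if dwin 0 x < 0 then 0 else if dwin 1 x < 0 then 1 else 2.

Lemma descentP x : (0 < len x)%N -> dwin (descent x) x < 0.
Proof.
move=> /desc_exists[i hi]; rewrite /descent; case: ifP => // h0.
case: ifP => // h1; move: hi.
by case: (ord3P i) => ->; rewrite ?h0 ?h1.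
Qed.

Fixpoint hrep_rec (n : nat) (x : eaw) (f : V) : V :=
  if n is n'.+1 then
    A (descent x) (hrep_rec n' (refl (descent x) * x)%g f)
  else iter (tau_exp x) U f.

(** The product of the operators along the reduced word that always strips the first left descent
    found. [hrep_desc] shows that any other left descent could be stripped instead. *)
Definition hrep (x : eaw) : V -> V := hrep_rec (len x) x.

Lemma hrep0 x f : len x = 0%N -> hrep x f = iter (tau_exp x) U f.
Proof. by rewrite /hrep => ->. Qed.

Lemma hrep_descent x f : (0 < len x)%N ->
  hrep x f = A (descent x) (hrep (refl (descent x) * x)%g f).
Proof. by move=> h; rewrite {1}/hrep (len_desc (descentP h)). Qed.

(* If i, j are two left descents of x, then x = s_i s_j s_i y with lengths
   adding up. *)
Lemma hrep_desc i x f : dwin i x < 0 -> hrep x f = A i (hrep (refl i * x)%g f).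
Proof.
elim: (len x).+1 {-2}x i (ltnSn (len x)) => // n IH {}x i xn hi.
have xpos : (0 < len x)%N by rewrite (len_desc hi).
have hd := descentP xpos; rewrite (hrep_descent _ xpos).
have step j k : dwin j x < 0 -> dwin k (refl j * x)%g < 0 ->
    dwin j (refl k * (refl j * x))%g < 0 ->
    A j (hrep (refl j * x)%g f) =
    A j (A k (A j (hrep (refl j * (refl k * (refl j * x)))%g f))).
  move=> h1 h2 h3.
  have l1 := len_desc h1; have l2 := len_desc h2.
  rewrite (IH (refl j * x)%g k) ?(IH (refl k * (refl j * x))%g j) //; lia.
have braidg a : (refl a * (refl (a + 1) * (refl a * x)) =
    refl (a + 1) * (refl a * (refl (a + 1) * x)))%g.
  by rewrite !mulgA -!(mulgA (refl _) (refl _) (refl _)) braid_refl.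
have two a : dwin a x < 0 -> dwin (a + 1) x < 0 ->
    A a (hrep (refl a * x)%g f) = A (a + 1) (hrep (refl (a + 1) * x)%g f).
  move=> ha hb.
  have add0 (p q : int) : p < 0 -> q < 0 -> p + q < 0 by lia.
  have a1 : dwin (a + 1) (refl a * x)%g < 0.
    by rewrite dwin_refl_next; exact: add0.
  (* The two reflections bring this pairing to [dwin (a + 1) x], so the descents continue down the
     whole braid word. *)
  have a2 : dwin a (refl (a + 1) * (refl a * x))%g < 0.
    by rewrite dwin_refl_prev dwin_refl_self dwin_refl_next addrC addrK.
  have b1 : dwin a (refl (a + 1) * x)%g < 0.
    by rewrite dwin_refl_prev; exact: add0.
  have b2 : dwin (a + 1) (refl a * (refl (a + 1) * x))%g < 0.
    by rewrite dwin_refl_next dwin_refl_self dwin_refl_prev addrC addrK.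
  rewrite (step a (a + 1)) // (step (a + 1) a) //.
  by rewrite braid braidg.
(* In the cyclic diagram any two distinct nodes are adjacent, so no commuting pair has to be
   considered. *)
case: (ord3_neq i (descent x)) => e.
- by rewrite e.
- by rewrite (two i) -?e.
- by rewrite e (two (descent x)) -?e.
Qed.

(** [U] permutes the [A i] as conjugation by [tau] permutes the reflections. At length zero the
    exponent wraps from 2 to 0, which is where [U3] enters. *)
Lemma hrep_tau x f : hrep (tau * x)%g f = U (hrep x f).
Proof.
elim: (len x) {-2}x (erefl (len x)) => {x} [|n IH] x hx.
  rewrite !hrep0 ?len_tau // tau_exp_tau //; case: eqP => [->|//].
  by rewrite /= U3.
have hd : dwin (descent x) x < 0 by apply: descentP; rewrite hx.
rewrite (hrep_desc _ hd) UA -IH; last by move: (len_desc hd); rewrite hx => -[].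
rewrite (@hrep_desc (descent x + 1)) ?dwin_tau //.
by rewrite mulgA -refl_tau -mulgA.
Qed.

Lemma hrep1 f : hrep 1%g f = f.
Proof.
rewrite hrep0 ?len1 // /tau_exp.
by have -> : eaw_fin 1%g = 1%g by []; rewrite perm1.
Qed.

End Matsumoto.

(** * Modules over the Hecke algebra *)

Lemma sum_partition_seq (I J : eqType) (M : nmodType) (r : seq I) (f : I -> J)
    (F : I -> M) :
  \sum_(p <- r) F p = \sum_(x <- undup (map f r)) \sum_(p <- r | f p == x) F p.
Proof.
rewrite (exchange_big_dep predT) //= big_seq [in RHS]big_seq.
apply: eq_bigr => p pr; rewrite (big_rem (f p)) /=; last first.
  by rewrite mem_undup map_f.
rewrite eqxx big1_seq ?addr0 // => x /andP[/eqP <-].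
by rewrite mem_rem_uniq ?undup_uniq // !inE eqxx.
Qed.

Section HeckeBasis.

Variables (H : algType laurent) (T : eaw -> H).
Hypothesis hT : is_hecke_basis T.

Definition combo (r : seq (laurent * eaw)) : H := \sum_(p <- r) p.1 *: T p.2.

Lemma combo_exists h : exists r, h = combo r.
Proof.
have [r [c ->]] := hecke_span hT h.
by exists [seq (c x, x) | x <- r]; rewrite /combo big_map.
Qed.

Lemma hecke_mulT x y : len (x * y)%g = (len x + len y)%N ->
  T x * T y = T (x * y)%g.
Proof. by move=> h; apply: (hecke_mul hT); rewrite !ellE. Qed.

(** [T 1] is a left identity on the basis, hence on all of [H]; evaluating at the unit identifies
    it. *)
Lemma T1 : T 1%g = 1.
Proof.
have T1x x : T 1%g * T x = T x by rewrite hecke_mulT ?mul1g ?len1.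
have T1h h : T 1%g * h = h.
  have [r ->] := combo_exists h; rewrite mulr_sumr; apply: eq_bigr => p _.
  by rewrite -scalerAr T1x.
by rewrite -[LHS]mulr1 T1h.
Qed.

Lemma len_refl1 i : len (refl i) = 1%N.
Proof. by have := len_refl i 1%g; rewrite mulg1 dwin1 len1. Qed.

Lemma len_tau1 : len tau = 0%N.
Proof. by rewrite -(mulg1 tau) len_tau len1. Qed.

Lemma T_sqr i : T (refl i) * T (refl i) = (v - vinv) *: T (refl i) + 1.
Proof.
have := hecke_quad hT (refl_simple i).
rewrite mulrDr !mulrBl -!(scalerAl, scalerAr) mulr1 !mul1r.
rewrite scalerA v_vinv scale1r => /eqP.
rewrite addrACA -opprD subr_eq0 addrC => /eqP e.
rewrite scalerBl; apply: (addIr (vinv *: T (refl i))).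
by rewrite addrC e addrAC subrK.
Qed.

Lemma T_refl i x : T (refl i) * T x =
  if dwin i x < 0 then T (refl i * x)%g + (v - vinv) *: T x
  else T (refl i * x)%g.
Proof.
case: ifP => h; last by rewrite hecke_mulT // len_refl h len_refl1.
have e : T x = T (refl i) * T (refl i * x)%g.
  by rewrite hecke_mulT ?reflKx // (len_desc h) len_refl1.
by rewrite {1}e mulrA T_sqr mulrDl mul1r addrC -scalerAl -e.
Qed.

Lemma T_tau x : T tau * T x = T (tau * x)%g.
Proof. by rewrite hecke_mulT // len_tau len_tau1. Qed.

Section Linear.

Variables (K : comNzRingType) (iota : {rmorphism laurent -> K}).

Section Functional.

Variables (W : lmodType K) (g : eaw -> W).

Definition combo_val (r : seq (laurent * eaw)) : W :=
  \sum_(p <- r) iota p.1 *: g p.2.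

Lemma combo_val_eq0 r : combo r = 0 -> combo_val r = 0.
Proof.
set c := fun x => \sum_(p <- r | p.2 == x) p.1.
have cE (R : nzRingType) (M : lmodType R) (j : {rmorphism laurent -> R})
    (f : eaw -> M) : \sum_(p <- r) j p.1 *: f p.2 =
    \sum_(x <- undup (map snd r)) j (c x) *: f x.
  rewrite (sum_partition_seq _ snd); apply: eq_bigr => x _.
  rewrite rmorph_sum scaler_suml; apply: eq_bigr => p /eqP <- //.
rewrite /combo (cE _ _ idfun) /combo_val (cE _ _ iota) /= => e.
rewrite big1_seq // => x /andP[_ xr].
by rewrite (hecke_free hT (undup_uniq _) e) // rmorph0 scale0r.
Qed.

(** The [iota]-semilinear extension of [g]. It is computed from an arbitrarily chosen expansion, and
    [lin_combo] removes the dependence on the choice. *)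
Definition lin (h : H) : W := combo_val (projT1 (cid (combo_exists h))).

Lemma lin_combo r : lin (combo r) = combo_val r.
Proof.
rewrite /lin; case: cid => s /= e; apply/eqP; rewrite -subr_eq0; apply/eqP.
have -> : combo_val s - combo_val r =
    combo_val (s ++ [seq (- p.1, p.2) | p <- r]).
  rewrite /combo_val big_cat big_map /= -sumrN; congr (_ + _).
  by apply: eq_bigr => p _; rewrite rmorphN scaleNr.
apply: combo_val_eq0; rewrite /combo big_cat big_map /=.
apply/eqP; rewrite addr_eq0 -sumrN -[X in X == _]e; apply/eqP.
by apply: eq_bigr => p _; rewrite scaleNr opprK.
Qed.

Lemma linT x : lin (T x) = g x.
Proof.
have -> : T x = combo [:: (1, x)] by rewrite /combo big_seq1 scale1r.
by rewrite lin_combo /combo_val big_seq1 rmorph1 scale1r.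
Qed.

Lemma linD h k : lin (h + k) = lin h + lin k.
Proof.
have [r ->] := combo_exists h; have [s ->] := combo_exists k.
have -> : combo r + combo s = combo (r ++ s) by rewrite /combo big_cat.
by rewrite !lin_combo /combo_val big_cat.
Qed.

Lemma linZ c h : lin (c *: h) = iota c *: lin h.
Proof.
have [r ->] := combo_exists h.
have -> : c *: combo r = combo [seq (c * p.1, p.2) | p <- r].
  rewrite /combo scaler_sumr big_map; apply: eq_bigr => p _.
  by rewrite scalerA.
rewrite !lin_combo /combo_val scaler_sumr big_map; apply: eq_bigr => p _.
by rewrite rmorphM scalerA.
Qed.

Lemma lin_sum (I : Type) (r : seq I) (F : I -> H) :
  lin (\sum_(i <- r) F i) = \sum_(i <- r) lin (F i).
Proof.
elim: r => [|i r IH]; last by rewrite !big_cons linD IH.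
rewrite !big_nil; apply: (addrI (lin 0)).
by rewrite -linD !addr0.
Qed.

End Functional.

Section Representation.

Variables (V : lmodType K) (A : 'I_3 -> {linear V -> V}) (U : {linear V -> V}).
Hypothesis UA : forall i f, U (A i f) = A (i + 1) (U f).
Hypothesis U3 : forall f, U (U (U f)) = f.
Hypothesis braid : forall i f,
  A i (A (i + 1) (A i f)) = A (i + 1) (A i (A (i + 1) f)).
Hypothesis quad : forall i f, A i (A i f) = iota (v - vinv) *: A i f + f.

Let rep := hrep (fun i => A i : V -> V) U.

Definition hact (h : H) (f : V) : V := lin (rep^~ f) h.

Lemma hactT x f : hact (T x) f = rep x f.
Proof. exact: linT. Qed.

(** This is the rule [T_refl] for left multiplication by [T (refl i)], now satisfied by the
    operators; comparing the two gives [hact_refl]. *)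
Lemma rep_refl i x f : A i (rep x f) =
  if dwin i x < 0 then rep (refl i * x)%g f + iota (v - vinv) *: rep x f
  else rep (refl i * x)%g f.
Proof.
have rd := @hrep_desc _ (fun i => A i : V -> V) U braid; case: ifP => h.
  by rewrite {1}/rep (rd i x f h) quad -(rd i x f h) addrC.
rewrite /rep [RHS](rd i (refl i * x)%g) ?reflKx //.
(* A pairing that is not negative is positive, as it cannot vanish, so [i] is a descent of
   [refl i * x]. *)
rewrite dwin_refl_self oppr_lt0 lt_def leNgt h andbT.
by apply: contraNneq (dwin_mod3 i x) => ->.
Qed.

Lemma hact_refl i h f : hact (T (refl i) * h) f = A i (hact h f).
Proof.
have [r ->] := combo_exists h.
rewrite /hact /combo mulr_sumr !lin_sum linear_sum.
apply: eq_bigr => -[c x] _ /=; rewrite -scalerAr !linZ linearZ /=.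
congr (_ *: _); rewrite T_refl linT rep_refl.
by case: ifP => _; rewrite ?linD ?linZ !linT.
Qed.

Lemma hact_tau h f : hact (T tau * h) f = U (hact h f).
Proof.
have [r ->] := combo_exists h.
rewrite /hact /combo mulr_sumr !lin_sum linear_sum.
apply: eq_bigr => -[c x] _ /=; rewrite -scalerAr !linZ linearZ /=.
congr (_ *: _); rewrite T_tau !linT; exact: hrep_tau.
Qed.

Lemma hact_mulT x h f : hact (T x * h) f = rep x (hact h f).
Proof.
elim: (len x) {-2}x (erefl (len x)) => {x} [|n IH] x hx.
  rewrite (len0 hx); elim: (2 - _)%N => [|k IHk].
    by rewrite expg0 T1 mul1r; exact/esym/hrep1.
  by rewrite expgS -T_tau -mulrA hact_tau IHk; apply/esym/hrep_tau.
have hd : dwin (descent x) x < 0 by apply: descentP; rewrite hx.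
have e : T x = T (refl (descent x)) * T (refl (descent x) * x)%g.
  by rewrite hecke_mulT ?reflKx // (len_desc hd) len_refl1.
rewrite e -mulrA hact_refl IH; last by move: (len_desc hd); rewrite hx => -[].
by apply/esym/hrep_desc.
Qed.

Lemma hactM h k f : hact (h * k) f = hact h (hact k f).
Proof.
have [r ->] := combo_exists h; rewrite /combo mulr_suml.
rewrite {1}/hact lin_sum [RHS]lin_sum; apply: eq_bigr => p _.
by rewrite -scalerAl !linZ -/(hact _ _) hact_mulT linT.
Qed.

End Representation.

End Linear.

End HeckeBasis.

(** * The module of label words *)

Definition triple : Type := (nat * nat * nat)%type.

Section TripleModule.

Variables (K : numFieldType) (z : K) (g : nat -> K) (om : K).

Let V := triple -> K^o.

(* The action of T_s on two adjacent letters a, b of a word, in terms of the values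
   p, r of a function at the word with a, b exchanged and at the word itself. *)
Definition hecke_coef (a b : nat) (p r : K) : K :=
  if (a < b)%N then p else if a == b then z * r else p + (z - z^-1) * r.

Definition opA1 (f : V) : V := fun x =>
  hecke_coef x.1.1 x.1.2 (f (x.1.2, x.1.1, x.2)) (f x).

Definition opA2 (f : V) : V := fun x =>
  hecke_coef x.1.2 x.2 (f (x.1.1, x.2, x.1.2)) (f x).

(** The exponents 2, -1, -1 are three times the coordinates of [omega1] projected to sum zero. Over
    three rotations the label weights cancel and only [om ^+ 3] remains. *)
Definition opU (f : V) : V := fun x =>
  om * (g x.1.1 ^+ 2 / (g x.1.2 * g x.2)) * f (x.1.2, x.2, x.1.1).

Lemma hecke_coef_linear a b c p1 r1 p2 r2 :
  hecke_coef a b (c * p1 + p2) (c * r1 + r2) =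
  c * hecke_coef a b p1 r1 + hecke_coef a b p2 r2.
Proof. by rewrite /hecke_coef; do 2 case: ifP => _ //; ring. Qed.

Lemma opA1_linear : linear opA1.
Proof. by move=> c f h; apply/funext => x; exact: hecke_coef_linear. Qed.

Lemma opA2_linear : linear opA2.
Proof. by move=> c f h; apply/funext => x; exact: hecke_coef_linear. Qed.

Lemma opU_linear : linear opU.
Proof.
move=> c f h; apply/funext => x.
rewrite /opU -[LHS]/(_ * (c * f _ + h _)) -[RHS]/(c * (_ * f _) + _ * h _).
ring.
Qed.

HB.instance Definition _ := GRing.isLinear.Build K V V *:%R opA1 opA1_linear.
HB.instance Definition _ := GRing.isLinear.Build K V V *:%R opA2 opA2_linear.
HB.instance Definition _ := GRing.isLinear.Build K V V *:%R opU opU_linear.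

(** Modelled on [s0 = tau * s2 * tau^-1], with [opU] applied twice in place of the inverse of
    [opU]. *)
Definition opA0 (f : V) : V := opU (opA2 (opU (opU f))).

Lemma opA0_linear : linear opA0.
Proof. by move=> c f h; rewrite /opA0 !linearP. Qed.

HB.instance Definition _ := GRing.isLinear.Build K V V *:%R opA0 opA0_linear.

Definition opA (i : 'I_3) : {linear V -> V} :=
  match nat_of_ord i with
  | 0%N => opA0 : {linear V -> V}
  | 1%N => opA1 : {linear V -> V}
  | _ => opA2 : {linear V -> V}
  end.

Hypotheses (z0 : z != 0) (g0 : forall a, g a != 0) (om3 : om ^+ 3 = 1).

Lemma opU3 f : opU (opU (opU f)) = f.
Proof.
apply/funext => -[[a b] c]; rewrite /opU /=.
have := g0 a; have := g0 b; have := g0 c => gc gb ga.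
transitivity (om ^+ 3 * f (a, b, c)); last by rewrite om3 mul1r.
by field; rewrite ga gb gc.
Qed.

Lemma hecke_coefM a b c p r :
  hecke_coef a b (c * p) (c * r) = c * hecke_coef a b p r.
Proof. by rewrite /hecke_coef; do 2 case: ifP => _ //; ring. Qed.

Lemma opU_A1 f : opU (opA1 f) = opA2 (opU f).
Proof.
apply/funext => -[[a b] c]; rewrite /opU /opA1 /opA2 /=.
by rewrite (mulrC (g c)) hecke_coefM.
Qed.

Lemma opA_U i f : opU (opA i f) = opA (i + 1) (opU f).
Proof.
case: (ord3P i) => ->; rewrite ?ord3S /opA /= /opA0.
- by rewrite -opU_A1 opU3.
- exact: opU_A1.
- by rewrite opU3.
Qed.

Lemma opA_quad1 f : opA1 (opA1 f) = (z - z^-1) *: opA1 f + f.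
Proof.
apply/funext => -[[a b] c]; rewrite -[RHS]/((z - z^-1) * opA1 f _ + f _).
rewrite /opA1 /hecke_coef /=.
by case: ltngtP => [ab|ab|->]; [ring|ring|field].
Qed.

Lemma opA_conj i f : opA (i + 1) f = opU (opA i (opU (opU f))).
Proof. by rewrite opA_U opU3. Qed.

(** Checked for [opA1] only; conjugation by [opU] carries the relation around the cycle. The braid
    relation below is obtained in the same way. *)
Lemma opA_quad i f : opA i (opA i f) = (z - z^-1) *: opA i f + f.
Proof.
have step j h : (forall h, opA j (opA j h) = (z - z^-1) *: opA j h + h) ->
    opA (j + 1) (opA (j + 1) h) = (z - z^-1) *: opA (j + 1) h + h.
  by move=> hj; rewrite !opA_conj opU3 hj linearD linearZ /= opU3.
have h2 h := step 1 h opA_quad1; rewrite ord3S in h2.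
have h0 h := step 2 h h2; rewrite ord3S in h0.
by case: (ord3P i) => ->; [exact: h0 | exact: opA_quad1 | exact: h2].
Qed.

Lemma opA_braid1 f : opA1 (opA2 (opA1 f)) = opA2 (opA1 (opA2 f)).
Proof.
apply/funext => -[[a b] c]; rewrite /opA1 /opA2 /hecke_coef /=.
by case: (ltngtP a b) => [ab|ab|ab]; case: (ltngtP b c) => [bc|bc|bc];
   case: (ltngtP a c) => [ac|ac|ac]; try (exfalso; lia);
   rewrite ?ab ?bc ?ltnn ?eqxx ?ac; try ring; subst; try field.
Qed.

Lemma opA_braid i f :
  opA i (opA (i + 1) (opA i f)) = opA (i + 1) (opA i (opA (i + 1) f)).
Proof.
have step j k : (forall h, opA j (opA k (opA j h)) = opA k (opA j (opA k h))) ->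
    forall h, opA (j + 1) (opA (k + 1) (opA (j + 1) h)) =
    opA (k + 1) (opA (j + 1) (opA (k + 1) h)).
  by move=> hj h; rewrite !opA_conj !opU3 hj.
have h1 : forall h, opA 1 (opA 2 (opA 1 h)) = opA 2 (opA 1 (opA 2 h)).
  exact: opA_braid1.
have h2 := step _ _ h1; have h0 := step _ _ h2.
rewrite !ord3S in h2 h0.
by case: (ord3P i) => ->; rewrite ?ord3S;
  [exact: h0 | exact: h1 | exact: h2].
Qed.

End TripleModule.

(** * Traces *)

Section Trace.

Variables (K : numFieldType) (J : seq triple).
Hypothesis Juniq : uniq J.

Let V := triple -> K^o.

Definition delta (b : triple) : V := fun x => (x == b)%:R.

(** [V] is infinite-dimensional, but such an operator induces one on the functions on [J], and
    [trace_op] is the trace of the latter. *)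
Definition local_op (F : V -> V) : Prop :=
  linear F /\ forall f h, {in J, f =1 h} -> {in J, F f =1 F h}.

Definition trace_op (F : V -> V) : K := \sum_(b <- J) F (delta b) b.

Lemma local_opE F f b : local_op F -> b \in J ->
  F f b = \sum_(a <- J) f a * F (delta a) b.
Proof.
move=> [lF JF] bJ.
pose Fl : {linear V -> V} := HB.pack F (GRing.isLinear.Build K V V *:%R F lF).
have -> : F f b = Fl (\sum_(a <- J) f a *: delta a) b.
  apply: JF => // x xJ; rewrite fct_sumE (big_rem x) //= big1_seq ?addr0.
    by rewrite -[RHS]/(f x * (x == x)%:R) eqxx mulr1.
  move=> y /andP[_]; rewrite mem_rem_uniq // inE => /andP[/negPf yx _].
  by rewrite -[LHS]/(f y * (x == y)%:R) eq_sym yx mulr0.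
by rewrite linear_sum fct_sumE; apply: eq_bigr => a _; rewrite linearZ.
Qed.

Lemma trace_opC F G : local_op F -> local_op G ->
  trace_op (F \o G) = trace_op (G \o F).
Proof.
move=> lF lG; rewrite /trace_op.
have E F' G' : local_op F' -> \sum_(b <- J) F' (G' (delta b)) b =
    \sum_(b <- J) \sum_(a <- J) G' (delta b) a * F' (delta a) b.
  by move=> lF'; apply: eq_big_seq => b bJ; exact: local_opE.
rewrite /= (E F G) // (E G F) // exchange_big.
by apply: eq_bigr => a _; apply: eq_bigr => b _; rewrite mulrC.
Qed.

Lemma local_op_comp F G : local_op F -> local_op G -> local_op (F \o G).
Proof.
move=> [lF JF] [lG JG]; split; first by move=> c f h /=; rewrite lG lF.
by move=> f h fh; apply: JF; apply: JG.
Qed.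

Lemma local_op_sum (I : Type) (r : seq I) (c : I -> K) (F : I -> V -> V) :
  (forall i, local_op (F i)) ->
  local_op (fun f => \sum_(i <- r) c i *: F i f).
Proof.
move=> lF; split=> [e f h|f h fh b bJ].
  rewrite scaler_sumr -big_split; apply: eq_bigr => i _ /=.
  by case: (lF i) => -> _; rewrite scalerDr !scalerA (mulrC e).
rewrite !fct_sumE; apply: eq_bigr => i _.
by rewrite -[LHS]/(c i * F i f b) -[RHS]/(c i * F i h b) ((lF i).2 f h).
Qed.

Lemma trace_op_sum (I : Type) (r : seq I) (c : I -> K) (F : I -> V -> V) :
  trace_op (fun f => \sum_(i <- r) c i *: F i f) =
  \sum_(i <- r) c i * trace_op (F i).
Proof.
rewrite /trace_op; under [RHS]eq_bigr do rewrite mulr_sumr.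
rewrite [RHS]exchange_big /=; apply: eq_bigr => b _.
by rewrite fct_sumE.
Qed.

Hypotheses
  (J1 : forall x : triple, x \in J -> (x.1.2, x.1.1, x.2) \in J)
  (J2 : forall x : triple, x \in J -> (x.1.1, x.2, x.1.2) \in J)
  (JU : forall x : triple, x \in J -> (x.1.2, x.2, x.1.1) \in J).

Variables (z : K) (g : nat -> K) (om : K).

Lemma local_opA i : local_op (opA z g om i).
Proof.
have l1 : local_op (opA1 z).
  split; first exact: opA1_linear.
  by move=> f h fh x xJ; rewrite /opA1 !fh // J1.
have l2 : local_op (opA2 z).
  split; first exact: opA2_linear.
  by move=> f h fh x xJ; rewrite /opA2 !fh // J2.
have lU : local_op (opU g om).
  split; first exact: opU_linear.
  by move=> f h fh x xJ; rewrite /opU !fh // JU.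
case: (ord3P i) => -> //.
exact: local_op_comp lU (local_op_comp l2 (local_op_comp lU lU)).
Qed.

Lemma local_opU : local_op (opU g om).
Proof.
split; first exact: opU_linear.
by move=> f h fh x xJ; rewrite /opU !fh // JU.
Qed.

Definition rho : eaw -> V -> V := hrep (fun i => opA z g om i : V -> V) (opU g om).

Lemma local_op_rho x : local_op (rho x).
Proof.
rewrite /rho /hrep; move: (len x) => n; elim: n x => [|n IH] x /=.
  elim: (tau_exp x) => [|k IHk] /=; first by split.
  exact: (local_op_comp local_opU IHk).
exact: (local_op_comp (local_opA _) (IH _)).
Qed.

Hypotheses (z0 : z != 0) (g0 : forall a, g a != 0) (om3 : om ^+ 3 = 1).

Variables (H : algType laurent) (T : eaw -> H).
Hypothesis hT : is_hecke_basis T.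
Variable iota : {rmorphism laurent -> K}.
Hypothesis iota_xi : iota (v - vinv) = z - z^-1.

Let act := hact hT iota (fun i => opA z g om i) (opU g om).

Lemma local_op_act h : local_op (act h).
Proof.
have [r ->] := combo_exists hT h.
have -> : act (combo T r) = (fun f => \sum_(p <- r) iota p.1 *: rho p.2 f).
  by apply/funext => f; rewrite /act /hact lin_combo.
by apply: local_op_sum => p; exact: local_op_rho.
Qed.

Lemma act_sum (I : Type) (r : seq I) (c : I -> laurent) (h : I -> H) :
  act (\sum_(i <- r) c i *: h i) = (fun f => \sum_(i <- r) iota (c i) *: act (h i) f).
Proof.
apply/funext => f; rewrite /act /hact lin_sum; apply: eq_bigr => i _.
exact: linZ.
Qed.

Lemma hact_opAM h k f : act (h * k) f = act h (act k f).
Proof.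
apply: hactM => [i e|e|i e|i e].
- exact: opA_U.
- exact: opU3.
- exact: opA_braid.
- rewrite iota_xi; exact: opA_quad.
Qed.

(** The action is multiplicative by [hact_opAM], so the cyclicity of the trace applies to each
    commutator. *)
Lemma trace_commutators h : commutators h -> trace_op (act h) = 0.
Proof.
move=> [r ->]; rewrite act_sum trace_op_sum big1 // => p _.
set x := p.2.1; set y := p.2.2.
have -> : x * y - y * x = \sum_(q <- [:: (1, x * y); (-1, y * x)]) q.1 *: q.2.
  by rewrite !big_cons big_nil /= addr0 scale1r scaleN1r.
have actC a b : act (a * b) = act a \o act b.
  by apply/funext => f; exact: hact_opAM.
rewrite act_sum trace_op_sum !big_cons big_nil /= addr0 rmorphN rmorph1 !actC.
rewrite mul1r mulN1r (trace_opC (local_op_act x) (local_op_act y)) subrr.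
exact: mulr0.
Qed.

Lemma trace_relation (I : Type) (r : seq I) (c : I -> laurent) (x : I -> eaw) :
  commutators (\sum_(i <- r) c i *: T (x i)) ->
  \sum_(i <- r) iota (c i) * trace_op (rho (x i)) = 0.
Proof.
move=> /trace_commutators; rewrite act_sum trace_op_sum => e; rewrite -[RHS]e.
apply: eq_bigr => i _; congr (_ * trace_op _).
by apply/funext => f; rewrite /act hactT.
Qed.

End Trace.

(** * Specialization at v = 1 *)

Definition label (b : triple) (i : 'I_3) : nat := nth 0%N [:: b.1.1; b.1.2; b.2] i.

Definition relabel (w : 'S_3) (b : triple) : triple :=
  (label b (w^-1%g 0), label b (w^-1%g 1), label b (w^-1%g 2)).

Definition coord_sum (l : P) : int := coord l 0 + coord l 1 + coord l 2.

(** Three times the projection to the plane of sum zero, hence independent of the representative in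
    Z^3 and exactly compatible with permutations. By contrast [coord_sum] is additive only modulo 3,
    which suffices because [om ^+ 3 = 1]. *)
Definition coord_exp (l : P) (i : 'I_3) : int := 3 * coord l i - coord_sum l.

Lemma label_relabel w b i : label (relabel w b) i = label b (w^-1%g i).
Proof. by case: (ord3P i) => ->. Qed.

Lemma triple_eq (b c : triple) : (forall i, label b i = label c i) -> b = c.
Proof.
case: b c => [[b0 b1] b2] [[c0 c1] c2] h.
have := (h 0, h 1, h 2); rewrite /label /= => -[[-> ->] ->] //.
Qed.

Lemma relabelM w u b : relabel (w * u)%g b = relabel u (relabel w b).
Proof. by apply: triple_eq => i; rewrite !label_relabel invMg permM. Qed.

Lemma relabel_fin (w u : 'S_3) b : (w * u = 1)%g ->
  relabel w b = (label b (u 0), label b (u 1), label b (u 2)).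
Proof.
move=> h; have -> : u = w^-1%g by rewrite -[u]mul1g -(mulVg w) -mulgA h mulg1.
by [].
Qed.

Lemma relabel_s1 b : relabel (eaw_fin s1) b = (b.1.2, b.1.1, b.2).
Proof.
rewrite (@relabel_fin _ (eaw_fin s1)) ?s1_fin //.
exact: (congr1 eaw_fin s1K).
Qed.

Lemma relabel_s2 b : relabel (eaw_fin s2) b = (b.1.1, b.2, b.1.2).
Proof.
rewrite (@relabel_fin _ (eaw_fin s2)) ?s2_fin //.
exact: (congr1 eaw_fin s2K).
Qed.

Lemma relabel_tau b : relabel (eaw_fin tau) b = (b.1.2, b.2, b.1.1).
Proof.
rewrite (@relabel_fin _ (eaw_fin (tau * tau)%g)); last first.
  by rewrite -eaw_finM mulgA tau3.
by rewrite !tau_finM !tau_fin.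
Qed.

Lemma coord_exp_mul u x i : coord_exp (eaw_trans (u * x)%g) i =
  coord_exp (eaw_trans u) i + coord_exp (eaw_trans x) (eaw_fin u i).
Proof.
rewrite eaw_transM /coord_exp /coord_sum !coordD !coord_act.
set w := eaw_fin u; set m := coord (eaw_trans x).
have -> : m 0 + m 1 + m 2 = m (w 0) + m (w 1) + m (w 2).
  have sumE (f : 'I_3 -> int) : f 0 + f 1 + f 2 = \sum_i f i.
    rewrite !big_ord_recr big_ord0 /= add0r.
    by congr (f _ + f _ + f _); apply: val_inj.
  by rewrite (sumE m) (sumE (m \o w)) (reindex_inj (@perm_inj _ w)).
ring.
Qed.

Lemma coord_sum_mul u x : exists k, coord_sum (eaw_trans (u * x)%g) =
  coord_sum (eaw_trans u) + coord_sum (eaw_trans x) - 3 * k.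
Proof.
exists (coord (eaw_trans x) (eaw_fin u 2)).
have := coord_exp_mul u x 2; rewrite [in X in _ -> X]eaw_transM.
rewrite /coord_exp eaw_transM coordD coord_act subrr addr0.
have aux (c s p q k : int) : 3 * c - s = 3 * c - p + (3 * k - q) ->
  s = p + q - 3 * k by lia.
exact: aux.
Qed.

Section Specialization.

Variables (K : numFieldType) (g : nat -> K) (om : K).
Hypotheses (g0 : forall a, g a != 0) (om3 : om ^+ 3 = 1).

Let V := triple -> K^o.

Definition weight (x : eaw) (b : triple) : K :=
  om ^ coord_sum (eaw_trans x) *
  \prod_i g (label b i) ^ coord_exp (eaw_trans x) i.

(** A monomial representation: translations act diagonally through [weight], and the finite part
    permutes the letters. Its traces can be read off from the words that are fixed. *)
Definition rho1 (x : eaw) (f : V) : V := fun b =>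
  weight x b * f (relabel (eaw_fin x) b).

Lemma om0 : om != 0.
Proof. by apply/negP => /eqP h; move/eqP: om3; rewrite h expr0n eq_sym oner_eq0. Qed.

Lemma om_shift c k : om ^ (c - 3 * k) = om ^ c.
Proof.
have -> : om ^ c = om ^ (c - 3 * k) * om ^ (3 * k).
  by rewrite -expfzDr ?om0 // subrK.
by rewrite -exprz_exp -[om ^ 3]/(om ^+ 3) om3 exp1rz mulr1.
Qed.

Lemma rho1M x y f : rho1 (x * y)%g f = rho1 x (rho1 y f).
Proof.
apply/funext => b; rewrite /rho1 relabelM mulrA; congr (_ * _).
rewrite /weight mulrACA; congr (_ * _).
  by have [k ->] := coord_sum_mul x y; rewrite om_shift expfzDr ?om0.
rewrite [X in _ = _ * X](reindex_inj (@perm_inj _ (eaw_fin x))) -big_split /=.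
apply: eq_bigr => i _.
by rewrite coord_exp_mul expfzDr // label_relabel permK.
Qed.

Lemma rho1_one f : rho1 1%g f = f.
Proof.
apply/funext => b; rewrite /rho1 /weight.
rewrite big1 => [|i _]; last by case: (ord3P i) => ->.
rewrite mulr1 expr0z mul1r; congr f; apply: triple_eq => i.
by rewrite label_relabel invg1 perm1.
Qed.

Lemma rho1_s1 f : rho1 s1 f = opA1 1 f.
Proof.
apply/funext => b; rewrite /rho1 /weight relabel_s1.
rewrite big1 => [|i _]; last by case: (ord3P i) => ->.
rewrite mulr1 expr0z mul1r /opA1 /hecke_coef invr1 subrr mul0r addr0.
by case: b => [[a b] c] /=; case: ltngtP => // ->; rewrite mul1r.
Qed.

Lemma rho1_s2 f : rho1 s2 f = opA2 1 f.
Proof.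
apply/funext => b; rewrite /rho1 /weight relabel_s2.
rewrite big1 => [|i _]; last by case: (ord3P i) => ->.
rewrite mulr1 expr0z mul1r /opA2 /hecke_coef invr1 subrr mul0r addr0.
by case: b => [[a b] c] /=; case: ltngtP => // ->; rewrite mul1r.
Qed.

Lemma rho1_tau f : rho1 tau f = opU g om f.
Proof.
apply/funext => b; rewrite /rho1 /weight relabel_tau tau_trans /opU.
congr (_ * _); rewrite expr1z; congr (_ * _).
rewrite !big_ord_recl big_ord0 mulr1 /= -[_ ^ _]/(g b.1.1 ^+ 2) invfM.
by congr (_ * (_ * _)).
Qed.

Lemma tau_conj_s2 : s0 = (tau * (s2 * (tau * tau)))%g.
Proof. by rewrite mulgA tau_s2 -mulgA (mulgA tau tau) tau3 mulg1. Qed.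

Lemma rho1_refl i f : rho1 (refl i) f = opA 1 g om i f.
Proof.
case: (ord3P i) => ->; [|exact: rho1_s1|exact: rho1_s2].
by rewrite /refl /= tau_conj_s2 rho1M rho1_tau rho1M rho1_s2 rho1M !rho1_tau.
Qed.

(** At parameter 1 the operators agree on the generators, and both sides are built along the same
    reduced word. *)
Lemma rho_specialize x : rho 1 g om x = rho1 x.
Proof.
apply/funext => f.
elim: (len x) {-2}x (erefl (len x)) => {x} [|n IH] x hx.
  rewrite [in RHS](len0 hx) -/(tau_exp x) /rho hrep0 //.
  elim: (tau_exp x) => [|k IHk].
    by rewrite rho1_one.
  by rewrite expgS rho1M rho1_tau -IHk.
have hd : dwin (descent x) x < 0 by apply: descentP; rewrite hx.
rewrite /rho hrep_descent ?hx // -/(rho _ _ _ _ _) IH; last first.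
  by move: (len_desc hd); rewrite hx => -[].
by rewrite -rho1_refl -rho1M reflKx.
Qed.

End Specialization.

(** * Conjugacy classes *)

Lemma conj_class_refl x : conj_class x x.
Proof. by exists 1%g => //; rewrite invg1 mulg1 mul1g. Qed.

Lemma conj_class_trans x y z : conj_class x y -> conj_class y z -> conj_class x z.
Proof.
move=> [a _ <-] [b _ <-]; exists (b * a)%g => //.
by rewrite invMg !mulgA.
Qed.

Lemma conj_class_sym x y : conj_class x y -> conj_class y x.
Proof.
move=> [a _ <-]; exists a^-1%g => //.
by rewrite invgK !mulgA mulVg mul1g -mulgA mulVg mulg1.
Qed.

Lemma conj_class_eq x y : conj_class x y -> conj_class x = conj_class y.
Proof.
move=> xy; apply/seteqP; split=> z; last exact: conj_class_trans.
exact/conj_class_trans/conj_class_sym.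
Qed.

Lemma conj_classesE O x : conj_classes O -> O x -> O = conj_class x.
Proof. by move=> [y _ <-]; exact: conj_class_eq. Qed.

Lemma perm3_neq (w : 'S_3) i j : i != j -> w i <> w j.
Proof. by move=> /eqP ij /perm_inj. Qed.

Lemma S3_cases (w : 'S_3) :
  [\/ w = 1%g, w = eaw_fin tau | w = (eaw_fin tau * eaw_fin tau)%g] \/
  [\/ w = eaw_fin s1, w = eaw_fin s2 | w = eaw_fin s0].
Proof.
have n01 := @perm3_neq w 0 1 isT; have n12 := @perm3_neq w 1 2 isT.
have n02 := @perm3_neq w 0 2 isT.
case: (ord3P (w 0)) => e0; case: (ord3P (w 1)) => e1; case: (ord3P (w 2)) => e2;
  first [ by case: n01; rewrite e0 e1 | by case: n12; rewrite e1 e2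
        | by case: n02; rewrite e0 e2
        | by left; constructor 1; apply: permS3_eq; rewrite ?e0 ?e1 ?e2 perm1
        | by left; constructor 2; apply: permS3_eq; rewrite ?e0 ?e1 ?e2 tau_fin
        | by left; constructor 3; apply: permS3_eq;
             rewrite ?e0 ?e1 ?e2 permM !tau_fin
        | by right; constructor 1; apply: permS3_eq; rewrite ?e0 ?e1 ?e2 s1_fin
        | by right; constructor 2; apply: permS3_eq; rewrite ?e0 ?e1 ?e2 s2_fin
        | by right; constructor 3; apply: permS3_eq;
             rewrite ?e0 ?e1 ?e2 s0_fin ].
Qed.

Lemma conj_t k l w :
  (t k * EAW l w * (t k)^-1 = EAW (l + (k - act w k)) w)%g.
Proof.
apply: eaw_eqP => [|i].
  rewrite !eaw_transM !eaw_finM /= mul1g !act1 invg1 act1 actN.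
  by rewrite addrA (addrC l).
by rewrite !eaw_finM /= mul1g invg1 mulg1.
Qed.

Lemma conj_fin u l w :
  (EAW 0 u * EAW l w * (EAW 0 u)^-1 = EAW (act u l) (u * w * u^-1))%g.
Proof.
apply: eaw_eqP => [|i]; last by rewrite !eaw_finM.
by rewrite !eaw_transM /= act0 oppr0 act0 addr0 add0r.
Qed.

(** Conjugation by [t k] moves [l] by [k - act w k]. For a reflection these vectors are multiples of
    the root, enough to clear the second coordinate. *)
Lemma conj_normal_refl l : exists c : int,
  conj_class (EAW l (eaw_fin s1)) (EAW (c, 0) (eaw_fin s1)).
Proof.
case: l => a b; exists (a + 2 * b), (t (b, 0)) => //.
rewrite conj_t s1E mulrz_pair; congr EAW.
rewrite -[LHS]/(a + (b - (b - 2 * b)), b + (0 - (0 - -1 * b))).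
by congr pair; ring.
Qed.

(** For the Coxeter element the vectors [k - act w k] fill the root lattice, of index 3 in [P], so
    only the residue of a - b modulo 3 survives. *)
Lemma conj_normal_cox l : exists2 c : int, 0 <= c < 3 &
  conj_class (EAW l (eaw_fin tau)) (EAW (c, 0) (eaw_fin tau)).
Proof.
case: l => a b; pose c := ((a - b) %% 3)%Z; exists c; first by rewrite /c; lia.
pose x := - ((a - b) %/ 3)%Z; exists (t (x, x - b)) => //.
rewrite conj_t; congr EAW; rewrite /act !tau_fin /coord /=.
rewrite -[LHS]/(a + (x - (0 - (x + (x - b)))), b + (x - b - (x + (x - b) - (x - b)))).
congr pair; rewrite /c /x; lia.
Qed.

Lemma conj_normal x : exists2 y, conj_class x y &
  [\/ exists l, y = EAW l 1%g, exists c : int, y = EAW (c, 0) (eaw_fin s1) |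
      exists2 c : int, 0 <= c < 3 & y = EAW (c, 0) (eaw_fin tau)].
Proof.
have conj u l w : conj_class (EAW l w) (EAW (act u l) (u * w * u^-1)%g).
  by exists (EAW 0 u) => //; exact: conj_fin.
have refl u l w : (u * w * u^-1 = eaw_fin s1)%g -> exists c : int,
    conj_class (EAW l w) (EAW (c, 0) (eaw_fin s1)).
  move=> e; have := conj u l w; rewrite e => h.
  have [c hc] := conj_normal_refl (act u l).
  by exists c; exact: conj_class_trans h hc.
have cox u l w : (u * w * u^-1 = eaw_fin tau)%g -> exists2 c : int, 0 <= c < 3 &
    conj_class (EAW l w) (EAW (c, 0) (eaw_fin tau)).
  move=> e; have := conj u l w; rewrite e => h.
  have [c c3 hc] := conj_normal_cox (act u l).
  by exists c => //; exact: conj_class_trans h hc.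
have fin_eq (a b c : eaw) : (a * b = c * a)%g ->
    (eaw_fin a * eaw_fin b * (eaw_fin a)^-1)%g = eaw_fin c.
  by move=> e; rewrite -eaw_finM e eaw_finM mulgK.
case: x => l w; case: (S3_cases w) => -[] ->.
- by exists (EAW l 1%g); [exact: conj_class_refl | constructor 1; exists l].
- have [c c3 h] := cox 1%g l (eaw_fin tau) (ltac:(by rewrite invg1 mulg1 mul1g)).
  by exists (EAW (c, 0) (eaw_fin tau)) => //; constructor 3; exists c.
- have e : (eaw_fin s1 * (eaw_fin tau * eaw_fin tau) * (eaw_fin s1)^-1)%g =
      eaw_fin tau.
    have -> : (eaw_fin s1 * (eaw_fin tau * eaw_fin tau) =
        eaw_fin tau * eaw_fin s1)%g.
      by apply: permS3_eq; rewrite (permM (eaw_fin s1)) !(permM (eaw_fin tau))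
        s1_fin !tau_fin ?s1_fin.
    exact: mulgK.
  have [c c3 h] := cox _ l _ e.
  by exists (EAW (c, 0) (eaw_fin tau)) => //; constructor 3; exists c.
- have [c h] := conj_normal_refl l.
  by exists (EAW (c, 0) (eaw_fin s1)) => //; constructor 2; exists c.
- have [c h] := refl (eaw_fin (tau * tau)%g) l _ (fin_eq (tau * tau)%g s2 s1
    (ltac:(by rewrite -(mulgA tau) tau_s2 (mulgA tau s0) tau_s0 -(mulgA s1)))).
  by exists (EAW (c, 0) (eaw_fin s1)) => //; constructor 2; exists c.
- have [c h] := refl (eaw_fin tau) l _ (fin_eq tau s0 s1 tau_s0).
  by exists (EAW (c, 0) (eaw_fin s1)) => //; constructor 2; exists c.
Qed.

(** * Characters *)

(** A Vandermonde argument: the relations extend from powers to all polynomials, in particular to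
    one that vanishes at every value [y i] except [a]. *)
Lemma power_sums_free (K : idomainType) (I : eqType) (r : seq I) (c y : I -> K) :
  (forall k, \sum_(i <- r) c i * y i ^+ k = 0) ->
  forall a, \sum_(i <- r | y i == a) c i = 0.
Proof.
move=> h a.
have hp (p : {poly K}) : \sum_(i <- r) c i * p.[y i] = 0.
  under eq_bigr do rewrite horner_coef mulr_sumr.
  rewrite exchange_big big1 // => j _ /=.
  under eq_bigr do rewrite mulrCA.
  by rewrite -mulr_sumr h mulr0.
pose q := \prod_(b <- [seq y i | i <- r] | b != a) ('X - b%:P).
have qa : q.[a] != 0.
  rewrite horner_prod prodf_seq_neq0; apply/allP => b _; apply/implyP => ba.
  by rewrite hornerXsubC subr_eq0 eq_sym.
apply: (mulIf qa); rewrite mul0r -[RHS](hp q) mulr_suml big_mkcond /=.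
apply: eq_big_seq => i ir; case: eqP => [->//|/eqP ya].
rewrite [q.[_]](_ : _ = 0) ?mulr0 // horner_prod.
apply/eqP; rewrite prodf_seq_eq0; apply/hasP; exists (y i); first exact: map_f.
by rewrite ya hornerXsubC subrr eqxx.
Qed.

(** Unique factorization, transported to a field of characteristic zero: 2 and 3 are
    multiplicatively independent. *)
Lemma exp23_inj (K : numFieldType) (a b c d : int) :
  2 ^ a * 3 ^ b = 2 ^ c * 3 ^ d :> K -> a = c /\ b = d.
Proof.
have n2 : 2 != 0 :> K by rewrite pnatr_eq0.
have n3 : 3 != 0 :> K by rewrite pnatr_eq0.
have nat1 m n : (2 ^ m * 3 ^ n = 1)%N -> (m = 0 /\ n = 0)%N.
  by move/eqP; rewrite muln_eq1 => /andP[]; case: m => [|m]; case: n => [|n];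
    rewrite ?expnS; lia.
have nat2 m n : (2 ^ m = 3 ^ n)%N -> (m = 0 /\ n = 0)%N.
  case: m => [|m].
    by move/eqP; rewrite expn0 eq_sym; case: n => // n; rewrite expnS; lia.
  move/(congr1 odd); rewrite oddX oddX /=; lia.
have natK m n : 2 ^+ m * 3 ^+ n = 1 :> K -> (m = 0 /\ n = 0)%N.
  rewrite -!natrX -natrM => /eqP; rewrite (eqr_nat K _ 1) => /eqP; exact: nat1.
have natK2 m n : 2 ^+ m = 3 ^+ n :> K -> (m = 0 /\ n = 0)%N.
  rewrite -!natrX => /eqP; rewrite eqr_nat => /eqP; exact: nat2.
have one (p q : int) : 2 ^ p * 3 ^ q = 1 :> K -> p = 0 /\ q = 0.
  move=> e; have [[m pm] [n qn]] : (exists m : nat, p = m \/ p = - m%:Z) /\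
      exists n : nat, q = n \/ q = - n%:Z.
    by split; [exists `|p|%N|exists `|q|%N]; lia.
  have m3 k : 3 ^+ k != 0 :> K by rewrite expf_neq0.
  have m2 k : 2 ^+ k != 0 :> K by rewrite expf_neq0.
  case: pm qn e => -> [] ->; rewrite -?exprnN -?exprnP.
  - by move=> /natK[-> ->].
  - by move=> /(canRL (divfK (m3 _))); rewrite mul1r => /natK2[-> ->].
  - by move=> /(canRL (mulVKf (m2 _))); rewrite mulr1 => /esym/natK2[-> ->].
  - by rewrite -invfM => /(congr1 GRing.inv); rewrite invrK invr1 => /natK[-> ->].
move=> e; have [|? ?] := one (a - c) (b - d); last by split; lia.
rewrite !expfzDr // mulrACA e mulrACA -!expfzDr // !subrr !expr0z mulr1 //.
Qed.

Definition labels_t : seq triple :=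
  [:: (0, 1, 2); (0, 2, 1); (1, 0, 2); (1, 2, 0); (2, 0, 1); (2, 1, 0)]%N.
Definition labels_r : seq triple := [:: (0, 0, 1); (0, 1, 0); (1, 0, 0)]%N.
Definition labels_e : seq triple := [:: (0, 0, 0)]%N.

Definition closed_labels (J : seq triple) : Prop :=
  [/\ uniq J, forall x : triple, x \in J -> (x.1.2, x.1.1, x.2) \in J,
      forall x : triple, x \in J -> (x.1.1, x.2, x.1.2) \in J &
      forall x : triple, x \in J -> (x.1.2, x.2, x.1.1) \in J].

Lemma closed_labelsP J : J \in [:: labels_t; labels_r; labels_e] ->
  closed_labels J.
Proof.
have check (Q : pred triple) : all Q J -> forall x, x \in J -> Q x.
  by move=> /allP.
by rewrite !inE => /or3P[] /eqP JE; rewrite JE in check *; split=> //;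
  apply: check.
Qed.

Lemma coord_exp_inj (l m : P) : (forall i, coord_exp l i = coord_exp m i) -> l = m.
Proof.
move=> h; apply: coord_inj => i j; have := h i; have := h j; rewrite /coord_exp.
set a := coord l i; set b := coord l j; set c := coord m i; set e := coord m j.
have aux (p q : int) : 3 * b - p = 3 * e - q -> 3 * a - p = 3 * c - q ->
  a - b = c - e by lia.
exact: aux.
Qed.

Lemma coord_exp_sum l : coord_exp l 0 + coord_exp l 1 + coord_exp l 2 = 0.
Proof. rewrite /coord_exp /coord_sum; ring. Qed.

Lemma coord_exp_act w l i : coord_exp (act w l) i = coord_exp l (w i).
Proof.
have := coord_exp_mul (EAW 0 w) (t l) i.
rewrite eaw_transM add0r => ->; rewrite [X in X + _](_ : _ = 0) ?add0r //.
by case: (ord3P i) => ->.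
Qed.

Section Characters.

Variables (K : numFieldType).

Let V := triple -> K^o.

Section ClassFunction.

Variables (g : nat -> K) (om : K) (J : seq triple).
Hypotheses (g0 : forall a, g a != 0) (om3 : om ^+ 3 = 1) (cJ : closed_labels J).

Lemma local_op_rho1 x : local_op J (rho1 g om x).
Proof.
by case: cJ => uJ J1 J2 JU; rewrite -rho_specialize //; exact: local_op_rho.
Qed.

Lemma trace_conj x y : conj_class x y ->
  trace_op J (rho1 g om y) = trace_op J (rho1 g om x).
Proof.
case: cJ => uJ _ _ _ [u _ <-].
have hom a b : rho1 g om (a * b)%g = rho1 g om a \o rho1 g om b.
  by apply/funext => f; rewrite rho1M.
rewrite hom trace_opC //; [|exact: local_op_rho1|exact: local_op_rho1].
by rewrite -hom mulgA mulVg mul1g.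
Qed.

Lemma trace_rho1 x : trace_op J (rho1 g om x) =
  \sum_(b <- J | relabel (eaw_fin x) b == b) weight g om x b.
Proof.
rewrite /trace_op [RHS]big_mkcond; apply: eq_bigr => b _.
by rewrite /rho1 /delta; case: eqP => _; rewrite ?mulr1 ?mulr0.
Qed.

End ClassFunction.

(** Letting [k] vary turns the traces into the k-th power sums of fixed weights ([weight_pow]), the
    input of [power_sums_free]. *)
Definition gpow (k : nat) (j : nat) : K := (nth 1 [:: 1; 2; 3] j) ^+ k.

Lemma gpow0 k j : gpow k j != 0.
Proof.
rewrite /gpow expf_neq0 //; case: j => [|[|[|j]]] /=; rewrite ?oner_eq0 //.
- by rewrite pnatr_eq0.
- by rewrite pnatr_eq0.
- by rewrite nth_nil oner_eq0.
Qed.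

Lemma weight_pow om k x b :
  weight (gpow k) (om ^+ k) x b = weight (gpow 1) om x b ^+ k.
Proof.
have powC (a : K) (n : int) : (a ^+ k) ^ n = (a ^ n) ^+ k.
  by rewrite !exprnP exprzAC.
rewrite /weight exprMn powC -prodrXl; congr (_ * _).
by apply: eq_bigr => i _; rewrite /gpow powC expr1.
Qed.

Lemma weight_t l b : weight (gpow 1) 1 (EAW l 1%g) b =
  \prod_i gpow 1 (label b i) ^ coord_exp l i.
Proof. by rewrite /weight exp1rz mul1r. Qed.

Lemma labels_tP b : b \in labels_t ->
  exists w : 'S_3, forall i, label b (w i) = nat_of_ord i.
Proof.
rewrite !inE => hb.
suff [u [h0 h1 h2]] : exists u : eaw, [/\ label b (eaw_fin u 0) = 0%N,
    label b (eaw_fin u 1) = 1%N & label b (eaw_fin u 2) = 2%N].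
  by exists (eaw_fin u) => i; case: (ord3P i) => ->.
move: hb => /orP[|/orP[|/orP[|/orP[|/orP[|]]]]] /eqP->.
- by exists 1%g; rewrite !perm1.
- by exists s2; rewrite !s2_fin.
- by exists s1; rewrite !s1_fin.
- by exists tau; rewrite !tau_fin.
- by exists (tau * tau)%g; rewrite !tau_finM !tau_fin.
- by exists s0; rewrite !s0_fin.
Qed.

(** After sorting the labels the weight is a product of powers of 2 and 3. Its exponents determine
    two values of [coord_exp], and the third follows because they sum to zero. *)
Lemma weight_t_inj l m b : b \in labels_t ->
  weight (gpow 1) 1 (EAW m 1%g) b = weight (gpow 1) 1 (EAW l 1%g) (0, 1, 2)%N ->
  exists w, l = act w m.
Proof.
move=> /labels_tP[w hw] e; exists w; move: e.
have std n : \prod_(i : 'I_3) gpow 1 i ^ coord_exp n i =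
    2 ^ coord_exp n 1 * 3 ^ coord_exp n 2 :> K.
  rewrite !big_ord_recl big_ord0 mulr1 /gpow /= !expr1 exp1rz mul1r.
  by congr (_ ^ coord_exp n _ * _ ^ coord_exp n _); apply: val_inj.
have : weight (gpow 1) 1 (EAW m 1%g) b =
    2 ^ coord_exp (act w m) 1 * 3 ^ coord_exp (act w m) 2.
  rewrite weight_t (reindex_inj (@perm_inj _ w)) -std.
  by apply: eq_bigr => i _; rewrite hw coord_exp_act.
have : weight (gpow 1) 1 (EAW l 1%g) (0, 1, 2)%N =
    2 ^ coord_exp l 1 * 3 ^ coord_exp l 2.
  rewrite weight_t -std; apply: eq_bigr => i _.
  by congr (gpow _ _ ^ _); case: (ord3P i) => ->.
move=> -> -> /exp23_inj[e1 e2]; apply: coord_exp_inj => i.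
have e0 : coord_exp l 0 = coord_exp (act w m) 0.
  have := coord_exp_sum l; have := coord_exp_sum (act w m).
  by rewrite e1 e2 => <- /addIr/addIr.
by case: (ord3P i) => ->; rewrite ?e0 ?e1 ?e2.
Qed.

Lemma weight_r c :
  weight (gpow 1) 1 (EAW (c, 0) (eaw_fin s1)) (0, 0, 1)%N = 2 ^ (- c).
Proof.
rewrite /weight exp1rz mul1r !big_ord_recl big_ord0 mulr1 /gpow /= !expr1.
rewrite !exp1rz !mul1r; congr (_ ^ _).
rewrite /coord_exp /coord_sum /coord /=; ring.
Qed.

Lemma weight_e om c : weight (gpow 1) om (EAW (c, 0) (eaw_fin tau)) (0, 0, 0)%N =
  om ^ c.
Proof.
rewrite /weight big1 ?mulr1 => [|i _]; last first.
  by case: (ord3P i) => ->; rewrite /gpow /= expr1 exp1rz.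
by congr (_ ^ _); rewrite /coord_sum /coord /=; ring.
Qed.

End Characters.

(** * Evaluation of Laurent polynomials *)

(** The coefficients attached to the value [w i b] sum to zero. Only the index [i] contributes, with
    a positive multiplicity, which can be cancelled in characteristic zero. *)
Lemma isolate_coef (K : numFieldType) (I : eqType) (r : seq I) (J : seq triple)
    (fx : I -> pred triple) (w : I -> triple -> K) (d : I -> K) i b : uniq r ->
  (forall k, \sum_(j <- r) d j * \sum_(a <- J | fx j a) w j a ^+ k = 0) ->
  i \in r -> b \in J -> fx i b ->
  (forall j a, j \in r -> a \in J -> fx j a -> w j a = w i b -> d j != 0 -> j = i) ->
  d i = 0.
Proof.
move=> ur h ir bJ fxb only.
pose c (p : I * triple) := if fx p.1 p.2 then d p.1 else 0.
have := @power_sums_free K _ [seq (j, a) | j <- r, a <- J] c (fun p => w p.1 p.2).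
move=> /(_ _ (w i b)); rewrite big_mkcond big_allpairs /= => H.
have {H} : \sum_(j <- r) \sum_(a <- J) (if w j a == w i b then c (j, a) else 0) = 0.
  apply: H => k; rewrite -[RHS](h k) big_allpairs; apply: eq_bigr => j _ /=.
  rewrite mulr_sumr [RHS]big_mkcond; apply: eq_bigr => a _.
  by rewrite /c /=; case: ifP => _; rewrite ?mul0r.
rewrite (big_rem i) //= [X in _ + X]big1_seq ?addr0 => [|j /andP[_ jr]]; last first.
  rewrite big1_seq // => a /andP[_ aJ]; case: eqP => // wab.
  rewrite /c /=; case: ifP => // fxa; apply/eqP/negP => /negP dj.
  have ji := only _ _ (mem_rem jr) aJ fxa wab dj.
  by move: jr; rewrite ji mem_rem_uniq // !inE eqxx.
have -> : \sum_(a <- J) (if w i a == w i b then c (i, a) else 0) =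
    d i *+ count (fun a => (w i a == w i b) && fx i a) J.
  rewrite -iter_addr_0 -big_const_seq [RHS]big_mkcond /=.
  by apply: eq_bigr => a _; rewrite /c /=; case: (w i a == w i b).
move/eqP; rewrite mulrn_eq0 => /orP[|/eqP//].
rewrite eqn0Ngt -has_count => /hasPn/(_ b bJ).
by rewrite eqxx fxb.
Qed.

Section Evaluation.

Variables (K : numFieldType).

Let polyK (p : {poly int}) : {poly K} := map_poly intr p.

Lemma laurent_frac (c : laurent) : exists pn : {poly int} * nat,
  laurent_val c = tofrac pn.1 / tofrac 'X ^+ pn.2.
Proof. by case: c => x px; have /asboolP[p [n e]] := px; exists (p, n). Qed.

Definition laurent_num (c : laurent) : {poly int} := (projT1 (cid (laurent_frac c))).1.
Definition laurent_den (c : laurent) : nat := (projT1 (cid (laurent_frac c))).2.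

Lemma laurent_numE c :
  laurent_val c = tofrac (laurent_num c) / tofrac 'X ^+ laurent_den c.
Proof. by rewrite /laurent_num /laurent_den; case: cid. Qed.

Definition laurent_eval (z : K) (c : laurent) : K :=
  (polyK (laurent_num c)).[z] / z ^+ laurent_den c.

Section Point.

Variables (z : K) (z0 : z != 0).

(** Evaluation was defined through a chosen fraction; cross-multiplication shows that any other
    fraction gives the same value. *)
Lemma laurent_evalE c p n : laurent_val c = tofrac p / tofrac 'X ^+ n ->
  laurent_eval z c = (polyK p).[z] / z ^+ n.
Proof.
rewrite laurent_numE /laurent_eval.
set q := laurent_num c; set m := laurent_den c => e.
have X0 k : tofrac ('X : {poly int}) ^+ k != 0.
  by rewrite expf_neq0 // fracX_neq0.
have {e} : tofrac (q * 'X^n) = tofrac (p * 'X^m).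
  rewrite !rmorphM !rmorphXn /=; apply/eqP; rewrite -eqr_div //.
  exact/eqP.
move=> /eqP; rewrite tofrac_eq => /eqP e.
apply/eqP; rewrite eqr_div ?expf_neq0 //; apply/eqP.
have := congr1 (fun s => (polyK s).[z]) e.
by rewrite /polyK !rmorphM !rmorphXn /= map_polyX !hornerM !hornerXn.
Qed.

Lemma laurent_eval_additive : zmod_morphism (laurent_eval z).
Proof.
have fracB (F : fieldType) (p q x y : F) : x != 0 -> y != 0 ->
    (p * y - q * x) / (x * y) = p / x - q / y.
  by move=> x0 y0; field; rewrite x0 y0.
move=> a b; have X0 k : tofrac ('X : {poly int}) ^+ k != 0.
  by rewrite expf_neq0 // fracX_neq0.
have zk k : z ^+ k != 0 by rewrite expf_neq0.
rewrite (@laurent_evalE _ (laurent_num a * 'X^(laurent_den b) -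
  laurent_num b * 'X^(laurent_den a)) (laurent_den a + laurent_den b)%N).
  rewrite /laurent_eval /polyK rmorphB !rmorphM !rmorphXn /= map_polyX.
  rewrite hornerD hornerN !hornerM !hornerXn exprD.
  by rewrite fracB.
rewrite -[LHS]/(laurent_val a - laurent_val b) !laurent_numE.
rewrite rmorphB !rmorphM !rmorphXn /= exprD.
by rewrite fracB.
Qed.

Lemma laurent_eval_multiplicative : monoid_morphism (laurent_eval z).
Proof.
split=> [|a b].
  by rewrite (@laurent_evalE _ 1 0%N) ?/polyK ?rmorph1 ?hornerC ?expr0 ?divr1 //.
rewrite (@laurent_evalE _ (laurent_num a * laurent_num b)
  (laurent_den a + laurent_den b)%N).
  by rewrite /laurent_eval /polyK rmorphM hornerM exprD invfM mulrACA.
rewrite -[LHS]/(laurent_val a * laurent_val b) !laurent_numE.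
by rewrite rmorphM exprD invfM mulrACA.
Qed.

HB.instance Definition _ :=
  GRing.isZmodMorphism.Build laurent K (laurent_eval z) laurent_eval_additive.
HB.instance Definition _ :=
  GRing.isMonoidMorphism.Build laurent K (laurent_eval z) laurent_eval_multiplicative.

Definition laurent_ev : {rmorphism laurent -> K} := laurent_eval z.

Lemma laurent_ev_xi : laurent_ev (v - vinv) = z - z^-1.
Proof.
rewrite rmorphB /laurent_ev /=.
rewrite (@laurent_evalE v 'X 0%N) ?expr0 ?divr1 // /polyK map_polyX hornerX.
rewrite (@laurent_evalE vinv 1 1%N) ?expr1 ?rmorph1 ?mul1r //.
by rewrite /polyK rmorph1 hornerC mul1r.
Qed.

End Point.

Lemma laurent_num_eq0 c : polyK (laurent_num c) = 0 -> c = 0.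
Proof.
move=> e; apply: val_inj; rewrite /= laurent_numE.
suff -> : laurent_num c = 0 by rewrite rmorph0 mul0r.
apply/polyP => i; have := congr1 (fun p : {poly K} => p`_i) e.
by rewrite coef_map !coef0 => /eqP; rewrite intr_eq0 => /eqP.
Qed.

Lemma laurent_evalX (z : K) c : z != 0 ->
  (polyK (laurent_num c)).[z] = laurent_eval z c * z ^+ laurent_den c.
Proof. by move=> z0; rewrite /laurent_eval divfK ?expf_neq0. Qed.

End Evaluation.

(** * Linear independence in the cocenter *)

Lemma relabel1 b : relabel 1%g b = b.
Proof. by apply: triple_eq => i; rewrite label_relabel invg1 perm1. Qed.

Section LaurentFunctions.

Variables (K : numFieldType).

Let V := triple -> K^o.

Definition laurent_fun (phi : K -> K) : Prop := exists (p : {poly K}) (n : nat),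
  forall z, z != 0 -> phi z * z ^+ n = p.[z].

Lemma laurent_fun_const a : laurent_fun (fun=> a).
Proof. by exists a%:P, 0%N => z _; rewrite expr0 mulr1 hornerC. Qed.

Lemma laurent_fun_id : laurent_fun (fun z => z).
Proof. by exists 'X, 0%N => z _; rewrite expr0 mulr1 hornerX. Qed.

Lemma laurent_fun_inv : laurent_fun GRing.inv.
Proof. by exists 1, 1%N => z z0; rewrite expr1 mulVf ?hornerC. Qed.

Lemma laurent_funD phi psi :
  laurent_fun phi -> laurent_fun psi -> laurent_fun (fun z => phi z + psi z).
Proof.
move=> [p [n hp]] [q [m hq]]; exists (p * 'X^m + q * 'X^n), (n + m)%N => z z0.
rewrite hornerD !hornerM !hornerXn -hp // -hq // exprD; ring.
Qed.

Lemma laurent_funM phi psi :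
  laurent_fun phi -> laurent_fun psi -> laurent_fun (fun z => phi z * psi z).
Proof.
move=> [p [n hp]] [q [m hq]]; exists (p * q), (n + m)%N => z z0.
by rewrite hornerM -hp // -hq // exprD mulrACA.
Qed.

Lemma laurent_fun_sum (I : Type) (r : seq I) (phi : I -> K -> K) :
  (forall i, laurent_fun (phi i)) -> laurent_fun (fun z => \sum_(i <- r) phi i z).
Proof.
move=> h; elim: r => [|i r IH].
  by under eq_fun do rewrite big_nil; exact: laurent_fun_const.
by under eq_fun do rewrite big_cons; exact: laurent_funD.
Qed.

(** An algebraic substitute for continuity at 1: the numerator has infinitely many roots 2, 3, 4,
    ..., hence is zero. *)
Lemma laurent_fun1 phi : laurent_fun phi ->
  (forall z, z != 0 -> z != 1 -> phi z = 0) -> phi 1 = 0.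
Proof.
move=> [p [n hp]] h; have := hp 1 (oner_neq0 K); rewrite expr1n mulr1 => ->.
suff -> : p = 0 by rewrite horner0.
apply: (@roots_geq_poly_eq0 K p [seq i.+2%:R | i <- iota 0 (size p)]).
- apply/allP => _ /mapP[i _ ->]; rewrite rootE -hp ?pnatr_eq0 // h ?mul0r //.
    by rewrite pnatr_eq0.
  by rewrite (eqr_nat K _ 1).
- rewrite map_inj_uniq ?iota_uniq // => i j /eqP.
  by rewrite eqr_nat => /eqP[].
- by rewrite size_map size_iota.
Qed.

Variables (g : nat -> K) (om : K).

Lemma laurent_fun_rho (f : K -> V) : (forall b, laurent_fun (f^~ b)) ->
  forall x b, laurent_fun (fun z => rho z g om x (f z) b).
Proof.
move=> hf x.
have coef a b phi psi : laurent_fun phi -> laurent_fun psi ->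
    laurent_fun (fun z => hecke_coef z a b (phi z) (psi z)).
  move=> h1 h2; rewrite /hecke_coef; case: (a < b)%N => //; case: (a == b).
    exact (laurent_funM laurent_fun_id h2).
  apply: laurent_funD => //; apply: laurent_funM => //.
  apply: laurent_funD laurent_fun_id _.
  under eq_fun do rewrite -mulN1r.
  exact: laurent_funM (laurent_fun_const _) laurent_fun_inv.
have l1 h : (forall b, laurent_fun (h^~ b)) ->
    forall b, laurent_fun (fun z => opA1 z (h z) b).
  by move=> hh b; apply: coef.
have l2 h : (forall b, laurent_fun (h^~ b)) ->
    forall b, laurent_fun (fun z => opA2 z (h z) b).
  by move=> hh b; apply: coef.
have lU (h : K -> V) : (forall b, laurent_fun (h^~ b)) ->
    forall b, laurent_fun (fun z => opU g om (h z) b).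
  by move=> hh b; apply: laurent_funM (laurent_fun_const _) (hh _).
have lA i h : (forall b, laurent_fun (h^~ b)) ->
    forall b, laurent_fun (fun z => opA z g om i (h z) b).
  move=> hh; case: (ord3P i) => ->; [|exact: l1|exact: l2].
  exact/lU/l2/lU/lU.
rewrite /rho /hrep; move: (len x) => n; elim: n x => [|n IH] x /=.
  by elim: (tau_exp x) => [|k IHk] //=; exact: lU.
exact/lA/IH.
Qed.

Lemma laurent_fun_trace J x : laurent_fun (fun z => trace_op J (rho z g om x)).
Proof.
apply: laurent_fun_sum => b; apply: (laurent_fun_rho (f := fun=> delta K b)) => a.
exact: laurent_fun_const.
Qed.

End LaurentFunctions.

Section Independence.

Variables (K : numFieldType) (zeta : K).
Hypothesis zeta_prim : 3.-primitive_root zeta.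

(** On the word of equal labels 0 every label weight is 1, so only [om] can tell the elliptic
    classes apart; hence the cube root [zeta] there. *)
Definition tests : seq (seq triple * K) :=
  [:: (labels_t, 1); (labels_r, 1); (labels_e, zeta)].

Lemma tests_om p k : p \in tests -> (p.2 ^+ k) ^+ 3 = 1.
Proof.
rewrite exprAC !inE => /or3P[] /eqP -> /=; rewrite ?expr1n //.
by rewrite (prim_expr_order zeta_prim) expr1n.
Qed.

Lemma tests_labels p : p \in tests -> closed_labels p.1.
Proof.
by move=> hp; apply: closed_labelsP; move: hp; rewrite !inE =>
  /or3P[] /eqP -> /=; rewrite ?eqxx ?orbT.
Qed.

Variables (r : seq (set eaw)) (x : set eaw -> eaw).
Hypotheses (ur : uniq r) (rC : {in r, forall O, conj_classes O})
  (xO : {in r, forall O, O (x O)}).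

(** The order of elimination is triangular. Words with distinct labels are fixed only by
    translations; words with two equal labels also by reflections; the constant word by everything.
    Each stage uses that the earlier coefficients already vanish. *)
Lemma characters_separate (d : set eaw -> K) :
  {in tests, forall p k, \sum_(O <- r)
     d O * trace_op p.1 (rho1 (@gpow K k) (p.2 ^+ k) (x O)) = 0} ->
  {in r, forall O, d O = 0}.
Proof.
move=> h.
(* Representatives are replaced by normal forms, which does not affect traces of a
   representation. *)
have [y hy] : exists y : set eaw -> eaw, forall O, O \in r ->
  conj_class (x O) (y O) /\
  [\/ exists l, y O = EAW l 1%g, exists c : int, y O = EAW (c, 0) (eaw_fin s1) |
      exists2 c : int, 0 <= c < 3 & y O = EAW (c, 0) (eaw_fin tau)].
  have /choice[y hy] : forall O, exists y, conj_class (x O) y /\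
    [\/ exists l, y = EAW l 1%g, exists c : int, y = EAW (c, 0) (eaw_fin s1) |
      exists2 c : int, 0 <= c < 3 & y = EAW (c, 0) (eaw_fin tau)].
    by move=> O; have [y h1 h2] := conj_normal (x O); exists y.
  by exists y => O _; exact: hy.
have same O O' : O \in r -> O' \in r -> conj_class (y O) (y O') -> O' = O.
  move=> Or O'r c.
  rewrite (conj_classesE (rC O'r) (xO O'r)) (conj_classesE (rC Or) (xO Or)).
  apply/esym/conj_class_eq/(conj_class_trans (hy O Or).1)/(conj_class_trans c).
  exact/conj_class_sym/(hy O' O'r).1.
have {}h p : p \in tests -> forall k, \sum_(O <- r) d O *
    \sum_(b <- p.1 | relabel (eaw_fin (y O)) b == b)
      weight (@gpow K 1) p.2 (y O) b ^+ k = 0.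
  move=> pt k; rewrite -[RHS](h p pt k); apply: eq_big_seq => O Or.
  rewrite -(trace_conj _ (tests_om k pt) (tests_labels pt) (hy O Or).1);
    last exact: gpow0.
  rewrite trace_rho1; congr (_ * _); apply: eq_bigr => b _.
  by rewrite -weight_pow.
have d_t O l : O \in r -> y O = EAW l 1%g -> d O = 0.
  move=> Or yl.
  apply: (isolate_coef (b := (0, 1, 2)%N) ur (h _ (mem_head _ _)) Or) => //.
    by rewrite yl /= relabel1.
  move=> O' b O'r bJ /eqP fb; rewrite yl => wE _.
  suff [m ym] : exists m, y O' = EAW m 1%g.
    rewrite ym in wE; have [w e] := weight_t_inj bJ wE.
    apply: same => //; rewrite yl ym e; apply: conj_class_sym.
    by exists (EAW 0 w) => //; rewrite conj_fin mulg1 mulgV.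
  case: (hy O' O'r).2 => [//|[c e]|[c _ e]]; move: fb; rewrite e /=.
    by rewrite relabel_s1; move: bJ; rewrite !inE;
      move=> /orP[|/orP[|/orP[|/orP[|/orP[|]]]]] /eqP->.
  by rewrite relabel_tau; move: bJ; rewrite !inE;
      move=> /orP[|/orP[|/orP[|/orP[|/orP[|]]]]] /eqP->.
have d_r O c : O \in r -> y O = EAW (c, 0) (eaw_fin s1) -> d O = 0.
  move=> Or yc.
  have t2 : (labels_r, 1) \in tests by rewrite !inE eqxx orbT.
  apply: (isolate_coef (b := (0, 0, 1)%N) ur (h _ t2) Or) => //.
    by rewrite yc relabel_s1.
  move=> O' b O'r bJ /eqP fb; rewrite yc weight_r => wE dO'.
  case: (hy O' O'r).2 => [[l e]|[c' e]|[c' _ e]].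
  - by move: dO'; rewrite (d_t _ _ O'r e) eqxx.
  - apply: same => //; rewrite yc e; move: fb wE; rewrite e relabel_s1.
    move: bJ; rewrite !inE => /or3P[] /eqP -> //= _; rewrite weight_r => e2.
    have [|cc _] := @exp23_inj K (- c') 0 (- c) 0; first by rewrite e2.
    by rewrite (oppr_inj cc); exact: conj_class_refl.
  - move: fb; rewrite e relabel_tau; move: bJ; rewrite !inE.
    by move=> /or3P[] /eqP ->.
move=> O Or; case: (hy O Or).2 => [[l e]|[c e]|[c c3 e]].
- exact: d_t Or e.
- exact: d_r Or e.
have t3 : (labels_e, zeta) \in tests by rewrite !inE eqxx !orbT.
apply: (isolate_coef (b := (0, 0, 0)%N) ur (h _ t3) Or) => //.
  by rewrite e relabel_tau.
move=> O' b O'r bJ _; rewrite e weight_e => wE dO'.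
case: (hy O' O'r).2 => [[l e']|[c' e']|[c' c3' e']].
- by move: dO'; rewrite (d_t _ _ O'r e') eqxx.
- by move: dO'; rewrite (d_r _ _ O'r e') eqxx.
apply: same => //; rewrite e e'; move: wE bJ; rewrite e' !inE.
move=> wE /eqP be; move: wE; rewrite be weight_e => wE.
suff -> : c' = c by exact: conj_class_refl.
(* Both exponents lie in [0, 3), so equality of powers of [zeta] forces them to agree. *)
case: c c3 {e be} wE => // c c3; case: c' c3' {e'} => // c' c3' /eqP.
rewrite -!exprnP (eq_prim_root_expr zeta_prim) => /eqP.
by rewrite !modn_small // => ->.
Qed.

Variables (H : algType laurent) (T : eaw -> H).
Hypothesis hT : is_hecke_basis T.

(* At v = 1 the traces are characters of the extended affine Weyl group, which
   separate conjugacy classes; a common factor v - 1 of the coefficients can be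
   cancelled because the traces take values in a domain. *)
Lemma class_basis_free (c : set eaw -> laurent) :
  commutators (\sum_(O <- r) c O *: T (x O)) -> {in r, forall O, c O = 0}.
Proof.
move=> hc; pose p O : {poly K} := map_poly intr (laurent_num (c O)).
suff p0 : {in r, forall O, p O = 0} by move=> O /p0/laurent_num_eq0.
have tests0 q : q \in tests -> forall k z, z != 0 ->
    \sum_(O <- r) laurent_eval z (c O) *
      trace_op q.1 (rho z (@gpow K k) (q.2 ^+ k) (x O)) = 0.
  move=> qt k z z0.
  have om3 := tests_om k qt; case: (tests_labels qt) => uJ J1 J2 JU.
  exact: (trace_relation uJ J1 J2 JU z0 (@gpow0 K k) om3 hT (laurent_ev_xi z0) hc).
(* Induction on a degree bound: separation at z = 1 gives every [C O] the root 1, and dividing by X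
   - 1 lowers the bound. *)
have descend n (C : set eaw -> {poly K}) :
    {in r, forall O, (size (C O) <= n)%N} ->
    (forall q, q \in tests -> forall k z, z != 0 -> \sum_(O <- r) (C O).[z] *
      trace_op q.1 (rho z (@gpow K k) (q.2 ^+ k) (x O)) = 0) ->
    {in r, forall O, C O = 0}.
  elim: n C => [|n IH] C sC hC O Or.
    by apply/eqP; rewrite -size_poly_eq0 -leqn0 sC.
  have root1 : {in r, forall O, (C O).[1] = 0}.
    apply: characters_separate => q qt k.
    rewrite -[RHS](hC q qt k 1 (oner_neq0 K)); apply: eq_bigr => O' _.
    by rewrite rho_specialize //; [exact: gpow0 | exact: tests_om].
  pose C' O := C O %/ ('X - 1%:P).
  have CE : {in r, forall O, C O = C' O * ('X - 1%:P)}.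
    by move=> O' O'r; rewrite divpK // dvdp_XsubCl; apply/eqP/root1.
  rewrite CE // (IH C' _ _ O Or) ?mul0r // => [O' O'r|q qt k z z0].
    by rewrite size_divp ?polyXsubC_eq0 // size_XsubC leq_subLR add1n sC.
  pose S z := \sum_(O <- r) (C' O).[z] *
      trace_op q.1 (rho z (@gpow K k) (q.2 ^+ k) (x O)).
  have S0 y : y != 0 -> y != 1 -> S y = 0.
    move=> y0 y1; have y1' : y - 1 != 0 by rewrite subr_eq0.
    apply: (mulIf y1'); rewrite mul0r -[RHS](hC q qt k y y0) /S mulr_suml.
    by apply: eq_big_seq => O' O'r; rewrite CE // hornerM hornerXsubC mulrAC.
  have [->|z1] := eqVneq z 1; last exact: S0.
  (* Division by z - 1 yields the relation away from 1 only; since it is Laurent polynomial in z, it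
     persists at 1. *)
  apply: (@laurent_fun1 _ S) => //; apply: laurent_fun_sum => O'.
  apply: laurent_funM; last exact: laurent_fun_trace.
  by exists (C' O'), 0%N => y _; rewrite expr0 mulr1.
(* A common power of z that clears all denominators. *)
pose N := (\sum_(O <- r) laurent_den (c O))%N.
have CN : {in r, forall O z, z != 0 ->
    (p O * 'X^(N - laurent_den (c O))).[z] = laurent_eval z (c O) * z ^+ N}.
  move=> O Or z z0; have dN : (laurent_den (c O) <= N)%N.
    by rewrite /N (big_rem O) //= leq_addr.
  by rewrite hornerM hornerXn /p laurent_evalX // -mulrA -exprD subnKC.
pose C O := p O * 'X^(N - laurent_den (c O)).
have C0 : {in r, forall O, C O = 0}.
  apply: (descend (\max_(O <- r) size (C O))%N).
    by move=> O Or; rewrite (big_rem O) //= leq_maxl.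
  move=> q qt k z z0; rewrite -[RHS](mulr0 (z ^+ N)) -[in RHS](tests0 q qt k z z0).
  rewrite mulr_sumr; apply: eq_big_seq => O Or.
  by rewrite CN // mulrA [_ * z ^+ N]mulrC.
move=> O /C0 /eqP; rewrite mulf_eq0 => /orP[/eqP//|].
by rewrite expf_eq0 polyX_eq0 andbF.
Qed.

End Independence.

(** * The classes containing reflections *)

(** Right multiplication by [tau] adds one constant to every window entry. *)
Lemma dwin_mulr_tau i x : dwin i (x * tau)%g = dwin i x.
Proof.
have [c winE] : exists c, forall j, win (x * tau)%g j = win x j + c.
  exists (1 - 3 * coord omega1 (eaw_fin x 2)) => j.
  rewrite /win eaw_transM eaw_finM permM coordD coord_act tau_trans.
  have -> : (eaw_fin tau (eaw_fin x j) : nat)%:Z =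
      3 * coord omega1 (eaw_fin x j) - 1 + (eaw_fin x j : nat)%:Z.
    by case: (ord3P (eaw_fin x j)) => ->; rewrite !tau_fin.
  ring.
have cancel (p q : int) : p + c - (q + c) = p - q by ring.
by case: (ord3P i) => ->; rewrite /dwin /= !winE cancel.
Qed.

Lemma len_mulr_tau x : len (x * tau)%g = len x.
Proof. by rewrite /len !dwin_mulr_tau. Qed.

Definition E0 (a b : int) : eaw := EAW (a, b) (eaw_fin s0).
Definition E1 (a b : int) : eaw := EAW (a, b) (eaw_fin s1).
Definition E2 (a b : int) : eaw := EAW (a, b) (eaw_fin s2).

Lemma len_E1 a b : len (E1 a b) = (`|(a - 1)%R| + `|b| + `|(a + b)%R|)%N.
Proof.
rewrite /len /dwin /win /= !(tpermL, tpermR) tpermD // /coord /=.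
lia.
Qed.

Lemma len_E0 a b : len (E0 a b) = (`|(a - 1)%R| + `|(b - 1)%R| + `|(a + b - 1)%R|)%N.
Proof.
rewrite /len /dwin /win /E0 [eaw_fin (EAW _ _)]/= [eaw_trans _]/= !s0_fin /coord /=.
lia.
Qed.

Lemma len_trans a b : len (EAW (a, b) 1%g) = (`|a| + `|b| + `|(a + b)%R|)%N.
Proof.
rewrite /len /dwin /win /= !perm1 /coord /=; lia.
Qed.

Lemma P_add (a b c d : int) : ((a, b) : P) + (c, d) = (a + c, b + d).
Proof. by []. Qed.

Lemma conj_E1_s1 a b : (s1 * E1 a b * s1 = E1 (- a) (a + b))%g.
Proof.
apply: eaw_eqP => [|i]; last by rewrite !eaw_finM /= tperm2 mul1g.
rewrite !eaw_transM act0 addr0 add0r /act !s1_fin /coord /=.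
congr pair; ring.
Qed.

Lemma mul_s1_E1 a b : (s1 * E1 a b = EAW (- a, a + b) 1)%g.
Proof.
apply: eaw_eqP => [|i]; last by rewrite !eaw_finM /= tperm2.
rewrite !eaw_transM add0r /act !s1_fin /coord /=.
congr pair; ring.
Qed.

Lemma conj_E1_s2 a b : (s2 * E1 a b * s2 = E0 (a + b) (- b))%g.
Proof.
apply: eaw_eqP => [|i].
  rewrite !eaw_transM act0 addr0 add0r /act !s2_fin /coord /=.
  congr pair; ring.
rewrite 2!eaw_finM 2!permM -[eaw_fin (E0 _ _)]/(eaw_fin s0).
rewrite -[eaw_fin (E1 _ _)]/(eaw_fin s1).
by case: (ord3P i) => ->; rewrite !s2_fin !s1_fin ?s2_fin s0_fin.
Qed.

Lemma tau_E1 a b : (tau * E1 a b = E2 (- (a + b)) a * tau)%g.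
Proof.
apply: eaw_eqP => [|i].
  rewrite (eaw_transM tau) (eaw_transM (E2 _ _)) tau_trans
    /act !tau_fin !s2_fin /coord /omega1 /= !P_add.
  congr pair; ring.
rewrite tau_finM eaw_finM permM -[eaw_fin (E1 _ _)]/(eaw_fin s1).
rewrite -[eaw_fin (E2 _ _)]/(eaw_fin s2).
by case: (ord3P i) => ->; rewrite !tau_fin !s1_fin ?s2_fin ?tau_fin.
Qed.

Lemma tau_E2 a b : (tau * E2 a b = E0 (1 - (a + b)) (1 + a) * tau)%g.
Proof.
apply: eaw_eqP => [|i].
  rewrite (eaw_transM tau) (eaw_transM (E0 _ _)) tau_trans
    /act !tau_fin !s0_fin /coord /omega1 /= !P_add.
  congr pair; ring.
rewrite tau_finM eaw_finM permM -[eaw_fin (E2 _ _)]/(eaw_fin s2).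
rewrite -[eaw_fin (E0 _ _)]/(eaw_fin s0).
by case: (ord3P i) => ->; rewrite !tau_fin !s2_fin ?s0_fin ?tau_fin.
Qed.

Lemma tau_E0 a b : (tau * E0 a b = E1 (2 - (a + b)) (a - 1) * tau)%g.
Proof.
apply: eaw_eqP => [|i].
  rewrite (eaw_transM tau) (eaw_transM (E1 _ _)) tau_trans
    /act !tau_fin !s1_fin /coord /omega1 /= !P_add.
  congr pair; ring.
rewrite tau_finM eaw_finM permM -[eaw_fin (E0 _ _)]/(eaw_fin s0).
rewrite -[eaw_fin (E1 _ _)]/(eaw_fin s1).
by case: (ord3P i) => ->; rewrite !tau_fin !s0_fin ?s1_fin ?tau_fin.
Qed.

Lemma qvecE m n : qvec m n = (2 * m - n, 2 * n - m).
Proof.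
rewrite /qvec !mulrz_pair P_add; congr pair; rewrite /=; ring.
Qed.

Lemma t_mul l m w : (t l * EAW m w = EAW (l + m) w)%g.
Proof. by apply: eaw_eqP => [|i]; rewrite ?eaw_transM ?act1 // eaw_finM mul1g. Qed.

Lemma s1s2s1tau : (s1 * s2 * s1 * tau = EAW (0, -1)%R (eaw_fin s1))%g.
Proof. eaw_compute. Qed.

Lemma s2tau : (s2 * tau = EAW (1, 0)%R (eaw_fin s0))%g.
Proof. rewrite /s0; eaw_compute. Qed.

Lemma s1tau : (s1 * tau = EAW (-1, 1)%R (eaw_fin s2))%g.
Proof. eaw_compute. Qed.

Lemma s2s1tau : (s2 * s1 * tau = EAW (0, -1)%R 1)%g.
Proof. eaw_compute. Qed.

(** This is $t^{k\alpha_1+i\alpha_2}s_1s_2s_1\tau$ in fundamental coweight coordinates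
    ([refl_eltE]); its finite part collapses to that of [s1]. *)
Definition refl_elt (i k : int) : eaw := E1 (2 * k - i) (2 * i - k - 1).

Lemma refl_eltE i k : (t (qvec k i) * s1 * s2 * s1 * tau)%g = refl_elt i k.
Proof.
rewrite -!(mulgA (t _)) s1s2s1tau t_mul qvecE P_add /refl_elt /E1.
by congr (EAW (_, _) _); ring.
Qed.

(** The two other families in [Oint_tau] are the conjugates of the first by [tau] and its square, so
    lengths in the class need only be computed for [refl_elt]. *)
Lemma refl_elt_tau i k :
  (t (qvec (1 - i) k) * s1 * tau)%g = (tau * refl_elt i (k + i) * tau^-1)%g.
Proof.
rewrite tau_E1 mulgK -(mulgA (t _)) s1tau t_mul qvecE P_add /E2.
by congr (EAW (_, _) _); ring.
Qed.

Lemma refl_elt_tau2 i k : (t (qvec (k + i - 1) k) * s2 * tau)%g =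
  (tau * (tau * refl_elt i (1 - k) * tau^-1) * tau^-1)%g.
Proof.
rewrite tau_E1 mulgK tau_E2 mulgK -(mulgA (t _)) s2tau t_mul qvecE P_add /E0.
by congr (EAW (_, _) _); ring.
Qed.

Lemma trans_eltE m n : (t (qvec m n) * s2 * s1 * tau)%g =
  EAW (2 * m - n, 2 * n - m - 1) 1%g.
Proof.
rewrite -!(mulgA (t _)) s2s1tau t_mul qvecE P_add.
by congr (EAW (_, _) _); ring.
Qed.

(** This reflection of k and the one in [conj_refl_elt_tau_s2] compose to a shift by one, which
    links all [refl_elt i k]. *)
Lemma conj_refl_elt_s1 i k : (s1 * refl_elt i k * s1)%g = refl_elt i (i - k).
Proof. by rewrite conj_E1_s1; congr (EAW (_, _) _); ring. Qed.

Lemma conj_refl_elt_tau_s2 i k :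
  (tau * (s2 * refl_elt i k * s2) * tau^-1)%g = refl_elt i (i + 1 - k).
Proof. by rewrite conj_E1_s2 tau_E0 mulgK; congr (EAW (_, _) _); ring. Qed.

Lemma involV (y : eaw) : (y * y = 1 -> y^-1 = y)%g.
Proof. by move=> h; rewrite -[LHS]mulg1 -h mulKg. Qed.

(** [s1] and [tau] generate the group: rotating [s1] by [tau] produces the other simple
    reflections. *)
Lemma conj_generators (S : set eaw) :
  (forall y, S y -> S (s1 * y * s1)%g) ->
  (forall y, S y -> S (tau * y * tau^-1)%g) ->
  forall x, S x -> conj_class x `<=` S.
Proof.
move=> Ss1 Stau x Sx _ [u _ <-].
have Srefl i y : S y -> S (refl i * y * (refl i)^-1)%g.
  have rot j : (forall y, S y -> S (refl j * y * (refl j)^-1)%g) ->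
      forall y, S y -> S (refl (j + 1) * y * (refl (j + 1))^-1)%g.
    move=> hj z Sz; have -> : refl (j + 1) = (tau * refl j * tau^-1)%g.
      by rewrite refl_tau mulgK.
    have -> : (tau^-1 = tau * tau)%g by rewrite -[LHS]mul1g -tau3 mulgK.
    have := Stau _ (hj _ (Stau _ (Stau _ Sz))).
    by rewrite !invMg !mulgA.
  have h1 z : S z -> S (refl 1%R * z * (refl 1%R)^-1)%g.
    have -> : ((refl 1%R)^-1 = s1)%g by exact: involV s1K.
    exact: Ss1.
  have h2 := rot _ h1; have h0 := rot _ h2; rewrite !ord3S in h2 h0.
  by case: (ord3P i) => -> Sy; [exact: h0 | exact: h1 | exact: h2].
have [_ [l [j [_ al ->]]]] := generatedP u.
elim: l al => [_|s l IH /= /andP[/simple_reflP[i ->] al]].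
  rewrite big_nil mul1g; elim: j => [|j IHj]; first by rewrite mul1g invg1 mulg1.
  by rewrite expgS invMg; have := Stau _ IHj; rewrite !mulgA.
rewrite big_cons -(mulgA (refl i)) invMg.
by have := Srefl i _ (IH al); rewrite !mulgA.
Qed.

Lemma tau_refl_elt i k : (tau * refl_elt i k * tau^-1)%g =
  E2 (1 - i - k) (2 * k - i).
Proof. by rewrite tau_E1 mulgK; congr (EAW (_, _) _); ring. Qed.

Lemma tau2_refl_elt i k : (tau * (tau * refl_elt i k * tau^-1) * tau^-1)%g =
  E0 (2 * i - k) (2 - i - k).
Proof. by rewrite tau_refl_elt tau_E2 mulgK; congr (EAW (_, _) _); ring. Qed.

Lemma conj_E2_s1 a b : (s1 * E2 a b * s1 = E0 (- a) (a + b))%g.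
Proof.
apply: eaw_eqP => [|i].
  rewrite !eaw_transM act0 addr0 add0r /act !s1_fin /coord /=.
  congr pair; ring.
rewrite 2!eaw_finM 2!permM -[eaw_fin (E0 _ _)]/(eaw_fin s0).
rewrite -[eaw_fin (E2 _ _)]/(eaw_fin s2).
by case: (ord3P i) => ->; rewrite !s1_fin !s2_fin ?s1_fin s0_fin.
Qed.

Lemma conj_E0_s1 a b : (s1 * E0 a b * s1 = E2 (- a) (a + b))%g.
Proof.
have -> : E0 a b = (s1 * E2 (- a) (a + b) * s1)%g.
  by rewrite conj_E2_s1; congr (EAW (_, _) _); ring.
by rewrite !mulgA s1K mul1g -mulgA s1K mulg1.
Qed.

Lemma Oint_refl_elt i x : Oint_tau i x <-> exists k, [\/ x = refl_elt i k,
  x = (tau * refl_elt i k * tau^-1)%g |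
  x = (tau * (tau * refl_elt i k * tau^-1) * tau^-1)%g].
Proof.
split=> -[k [] ->].
- by exists k; constructor 1; rewrite refl_eltE.
- by exists (1 - k); constructor 3; rewrite refl_elt_tau2.
- by exists (k + i); constructor 2; rewrite refl_elt_tau.
- by exists k; constructor 1; rewrite refl_eltE.
- by exists (k - i); constructor 3; rewrite refl_elt_tau subrK.
- exists (1 - k); constructor 2; rewrite refl_elt_tau2.
  by have -> : 1 - (1 - k) = k by ring.
Qed.

Lemma conj_class_tau x : conj_class x (tau * x * tau^-1)%g.
Proof. by exists tau. Qed.

Lemma conj_class_fn u x y : (u * x * u^-1)%g = y -> conj_class x y.
Proof. by exists u. Qed.

Lemma refl_elt_conj i k : conj_class (refl_elt i 0) (refl_elt i k).
Proof.
have shift m : conj_class (refl_elt i m) (refl_elt i (m + 1)).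
  have V1 := involV s1K; have V2 := involV s2K.
  apply: (conj_class_trans (y := refl_elt i (i - m))).
    by apply: (@conj_class_fn s1); rewrite V1 conj_refl_elt_s1.
  apply: (@conj_class_fn (tau * s2)%g); rewrite invMg V2.
  have := conj_refl_elt_tau_s2 i (i - m); rewrite !mulgA => ->.
  by congr refl_elt; ring.
elim/int_rect: k => [|n IH|n IH]; first exact: conj_class_refl.
  by apply: conj_class_trans IH _; rewrite intS addrC; exact: shift.
apply: conj_class_trans IH _; apply: conj_class_sym.
have -> : - n%:Z = - n.+1%:Z + 1 by lia.
exact: shift.
Qed.

(** One inclusion follows from the shifts of k, the other from stability of the three listed
    families under the generators. *)
Lemma Oint_conj i k : Oint_tau i = conj_class (refl_elt i k).
Proof.
apply/seteqP; split=> x; first rewrite Oint_refl_elt.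
  have conj m := conj_class_trans (conj_class_sym (refl_elt_conj i k))
    (refl_elt_conj i m).
  case=> m [] ->; first exact: conj.
  - exact: conj_class_trans (conj m) (conj_class_tau _).
  - apply: conj_class_trans (conj_class_tau _).
    exact: conj_class_trans (conj m) (conj_class_tau _).
apply: conj_generators; last by rewrite Oint_refl_elt; exists k; constructor 1.
- move=> y; rewrite !Oint_refl_elt => -[m [] ->].
  + by exists (i - m); constructor 1; rewrite conj_refl_elt_s1.
  + exists (i + 1 - m); constructor 3; rewrite tau2_refl_elt tau_refl_elt.
    by rewrite conj_E2_s1; congr (EAW (_, _) _); ring.
  + exists (i + 1 - m); constructor 2; rewrite tau2_refl_elt tau_refl_elt.
    by rewrite conj_E0_s1; congr (EAW (_, _) _); ring.
- move=> y; rewrite !Oint_refl_elt => -[m [] ->].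
  + by exists m; constructor 2.
  + by exists m; constructor 3.
  + exists m; constructor 1; rewrite tau2_refl_elt tau_E0 mulgK.
    by congr (EAW (_, _) _); ring.
Qed.

(** * Reduction in the cocenter *)

Section Cocenter.

Variables (H : algType laurent) (T : eaw -> H).
Hypothesis hT : is_hecke_basis T.

Definition cong (h k : H) : Prop := commutators (h - k).

Lemma commutators0 : @commutators H 0.
Proof. by exists [::]; rewrite big_nil. Qed.

Lemma commutatorsD (h k : H) :
  commutators h -> commutators k -> commutators (h + k).
Proof. by move=> [r ->] [s ->]; exists (r ++ s); rewrite big_cat. Qed.

Lemma commutatorsZ c (h : H) : commutators h -> commutators (c *: h).
Proof.
move=> [r ->]; exists [seq (c * p.1, p.2) | p <- r].
by rewrite big_map scaler_sumr; apply: eq_bigr => p _; rewrite scalerA.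
Qed.

Lemma cong_refl h : cong h h.
Proof. by rewrite /cong subrr; exact: commutators0. Qed.

Lemma cong_sym h k : cong h k -> cong k h.
Proof. by move=> /(commutatorsZ (-1)); rewrite scaleN1r opprB. Qed.

Lemma cong_trans k h l : cong h k -> cong k l -> cong h l.
Proof. by move=> /commutatorsD h1 /h1; rewrite addrA subrK. Qed.

Lemma congD h h' k k' : cong h h' -> cong k k' -> cong (h + k) (h' + k').
Proof. by move=> /commutatorsD h1 /h1; rewrite addrACA -opprD. Qed.

Lemma congZ c h k : cong h k -> cong (c *: h) (c *: k).
Proof. by move=> /(commutatorsZ c); rewrite scalerBr. Qed.

Lemma cong_sum (I : eqType) (r : seq I) (F G : I -> H) :
  {in r, forall i, cong (F i) (G i)} ->
  cong (\sum_(i <- r) F i) (\sum_(i <- r) G i).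
Proof.
elim: r => [|i r IH] h; first by rewrite !big_nil; exact: cong_refl.
rewrite !big_cons; apply: congD; first by apply: h; rewrite mem_head.
by apply: IH => j jr; apply: h; rewrite inE jr orbT.
Qed.

Lemma cong_mulC h k : cong (h * k) (k * h).
Proof. by exists [:: (1, (h, k))]; rewrite big_seq1 scale1r. Qed.

(** With [w] inverse to [u], the elements [a] and [b] are the two products of [w] and [b * u]. *)
Lemma cong_intertwine (u w a b : H) : u * w = 1 -> w * u = 1 -> u * a = b * u ->
  cong a b.
Proof.
move=> uw wu e.
have -> : a = w * (b * u) by rewrite -e mulrA wu mul1r.
have eb : b = b * u * w by rewrite -mulrA uw mulr1.
rewrite [X in cong _ X]eb; exact: cong_mulC.
Qed.

Lemma cong_conj_tau x : cong (T x) (T (tau * x * tau^-1)%g).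
Proof.
apply: (@cong_intertwine (T tau) (T (tau * tau)%g)).
- by rewrite T_tau // mulgA tau3 (T1 hT).
- rewrite hecke_mulT // ?tau3 ?(T1 hT) //.
  by rewrite !len_tau len1 len_tau1.
- rewrite T_tau // hecke_mulT ?mulgKV // len_tau1 addn0.
  by rewrite -[RHS]len_mulr_tau mulgKV.
Qed.

Lemma T_mulr_refl i x : len (x * refl i)%g = (len x).+1 ->
  T x * T (refl i) = T (x * refl i)%g.
Proof. by move=> h; rewrite hecke_mulT // h len_refl1 addn1. Qed.

Lemma T_mull_refl i x : dwin i x < 0 -> T x = T (refl i) * T (refl i * x)%g.
Proof. by move=> h; rewrite hecke_mulT // ?reflKx // (len_desc h) len_refl1. Qed.

Lemma refl_conjK i x : (refl i * x * refl i * refl i = refl i * x)%g.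
Proof. by rewrite -(mulgA (refl i * x)%g) reflK mulg1. Qed.

(** If [i] is a left descent, the factor [T (refl i)] is moved cyclically to the right. Otherwise
    both [T (refl i) * T x] and [T (refl i * x * refl i) * T (refl i)] equal [T (refl i * x)], and
    [T (refl i)] is invertible. *)
Lemma cong_conj_refl i x : len (refl i * x * refl i)%g = len x ->
  cong (T x) (T (refl i * x * refl i)%g).
Proof.
move=> lx; case: (ltP (dwin i x) 0) => h.
  rewrite (T_mull_refl h); apply: cong_trans (cong_mulC _ _) _.
  rewrite T_mulr_refl; first exact: cong_refl.
  by rewrite lx (len_desc h).
have ls : len (refl i * x)%g = (len x).+1 by rewrite len_refl ltNge h.
(* The inverse of [T (refl i)], read off from the quadratic relation. *)
pose w := T (refl i) - (v - vinv) *: 1.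
have sw : T (refl i) * w = 1.
  by rewrite /w mulrBr (T_sqr hT) -scalerAr mulr1 addrC addKr.
have ws : w * T (refl i) = 1.
  by rewrite /w mulrBl (T_sqr hT) -scalerAl mul1r addrC addKr.
apply: (cong_intertwine sw ws).
rewrite T_mulr_refl refl_conjK ?ls ?lx // hecke_mulT //.
by rewrite ls len_refl1.
Qed.

(** Moving [T (refl i)] cyclically creates its square on the right; the quadratic relation splits
    this into the two terms. *)
Lemma cong_conj_down i x : dwin i x < 0 ->
  len x = (len (refl i * x * refl i)%g).+2 ->
  cong (T x) (T (refl i * x * refl i)%g + (v - vinv) *: T (refl i * x)%g).
Proof.
move=> h lx; have ls := len_desc h.
have e : T (refl i * x)%g = T (refl i * x * refl i)%g * T (refl i).
  by rewrite T_mulr_refl ?refl_conjK //; lia.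
rewrite (T_mull_refl h); apply: cong_trans (cong_mulC _ _) _.
rewrite {1}e -mulrA (T_sqr hT) mulrDr mulr1 -scalerAr -e addrC.
exact: cong_refl.
Qed.

(** This is $t^{k\alpha_1+i\alpha_2}s_2s_1\tau$, a pure translation because [s2 * s1 * tau] has
    trivial finite part ([trans_eltE]). *)
Definition trans_elt (i k : int) : eaw := EAW (2 * k - i, 2 * i - k - 1) 1%g.

(* The values of k for which k |-> i + 1 - k preserves the length of
   refl_elt i k. *)
Definition flip_range (i k : int) : Prop :=
  2 - i <= k <= 2 * i - 1 \/ 2 * i <= k <= 1 - i.

Lemma cong_flip i k : flip_range i k ->
  cong (T (refl_elt i k)) (T (refl_elt i (i + 1 - k))).
Proof.
move=> hk; rewrite -conj_refl_elt_tau_s2.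
apply: cong_trans (cong_conj_tau _); apply: (@cong_conj_refl 2).
rewrite -[refl 2]/s2 conj_E1_s2 len_E0 len_E1.
by case: hk => hk; lia.
Qed.

Lemma dwin_E1 a b : dwin 1 (E1 a b) = 3 * a - 1.
Proof. by rewrite /dwin /win /= !(tpermL, tpermR) /coord /=; lia. Qed.

(** The bound [i + 3 <= 2 * k] makes the first coordinate of the flipped element negative, which is
    what lets conjugation by [s1] shorten it by two. *)
Lemma cong_step i k : flip_range i k -> i + 3 <= 2 * k ->
  cong (T (refl_elt i k))
    (T (refl_elt i (k - 1)) + (v - vinv) *: T (trans_elt i (k - 1))).
Proof.
move=> hk ik; apply: cong_trans (cong_flip hk) _.
have -> : refl_elt i (k - 1) = (s1 * refl_elt i (i + 1 - k) * s1)%g.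
  by rewrite conj_refl_elt_s1; congr refl_elt; ring.
have -> : trans_elt i (k - 1) = (s1 * refl_elt i (i + 1 - k))%g.
  by rewrite mul_s1_E1; congr (EAW (_, _) _); ring.
apply: (@cong_conj_down 1); first by rewrite dwin_E1; lia.
rewrite -[refl 1]/s1 conj_E1_s1 !len_E1.
by case: hk => hk; lia.
Qed.

(** The least k with 2k > i, where [cong_step] stops applying. *)
Definition base (i : int) : int := (i %/ 2)%Z + 1.

Lemma cong_reduce i n : flip_range i (base i + n%:Z) ->
  cong (T (refl_elt i (base i + n%:Z))) (T (refl_elt i (base i)) +
    (v - vinv) *: \sum_(j <- iota 0 n) T (trans_elt i (base i + j%:Z))).
Proof.
elim: n => [|n IH] hn.
  by rewrite big_nil scaler0 !addr0; exact: cong_refl.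
apply: (cong_trans (cong_step hn _)); first by rewrite /base; lia.
have -> : base i + n.+1%:Z - 1 = base i + n%:Z by lia.
rewrite -addn1 iotaD big_cat big_seq1 add0n /= scalerDr addrA.
apply: congD (cong_refl _); apply: IH.
by move: hn; rewrite /flip_range /base; lia.
Qed.

(** The class of a translation is its finite Weyl orbit, on which length is constant, so every
    conjugation by a generator is a congruence. *)
Lemma cong_trans_class l y : conj_class (EAW l 1%g) y -> cong (T y) (T (EAW l 1%g)).
Proof.
have main : conj_class (EAW l 1%g) `<=`
    [set y | eaw_fin y = 1%g /\ cong (T (EAW l 1%g)) (T y)].
  apply: conj_generators => [z [fy cy]|z [fy cy]|]; last first.
  - by split=> //; exact: cong_refl.
  - split; last exact: cong_trans cy (cong_conj_tau z).
    by rewrite !eaw_finM fy mulg1 mulgV.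
  - have s1f : (eaw_fin s1 * eaw_fin s1)%g = 1%g by exact: (congr1 eaw_fin s1K).
    have fy' : eaw_fin (s1 * z * s1)%g = 1%g by rewrite 2!eaw_finM fy mulg1.
    split=> //; apply: cong_trans cy _; apply: (@cong_conj_refl 1).
    rewrite -[refl 1]/s1; case: z fy fy' => -[a b] w /= -> _.
    rewrite (_ : s1 * _ * s1 = EAW (- a, a + b) 1)%g ?len_trans; first lia.
    apply: eaw_eqP => [|i]; last by rewrite 2!eaw_finM mulg1 s1f.
    rewrite !eaw_transM act0 addr0 add0r /act !s1_fin /coord /=.
    congr pair; ring.
by move=> /main[_ /cong_sym].
Qed.

Lemma cong_min_refl i y : min_length (Oint_tau i) y ->
  cong (T y) (T (refl_elt i (base i))).
Proof.
move=> [Oy miny].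
have len_tau_conj x : len (tau * x * tau^-1)%g = len x.
  by rewrite -len_mulr_tau mulgKV len_tau.
have [k [yk ly]] : exists k, cong (T (refl_elt i k)) (T y) /\
    len y = len (refl_elt i k).
  move: Oy; rewrite Oint_refl_elt => -[k [] ->]; exists k.
  - by split=> //; exact: cong_refl.
  - by rewrite len_tau_conj; split=> //; exact: cong_conj_tau.
  - rewrite !len_tau_conj; split=> //.
    exact: cong_trans (cong_conj_tau _) (cong_conj_tau _).
apply: (cong_trans (cong_sym yk)).
have Ob : Oint_tau i (refl_elt i (base i)).
  by rewrite Oint_refl_elt; exists (base i); constructor 1.
have := miny _ Ob; rewrite !ellE ly !len_E1 => lk.
(* The length formula leaves only these two indices as minimal; the flip exchanges them, and they
   coincide for odd i. *)
have [->|->] : k = base i \/ k = i + 1 - base i.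
- by move: lk; rewrite /base; lia.
- exact: cong_refl.
- apply/cong_sym/cong_flip; rewrite /flip_range /base; lia.
Qed.

End Cocenter.

(** * Class polynomials *)

Lemma min_length_exists O : conj_classes O -> exists x, min_length O x.
Proof.
move=> [x _ <-].
have ex : exists n, `[< exists2 y, conj_class x y & ell y = n >].
  by exists (ell x); apply/asboolP; exists x => //; exact: conj_class_refl.
case: (ex_minnP ex) => n /asboolP[y xy <-] hmin; exists y; split=> // z xz.
by apply: hmin; apply/asboolP; exists z.
Qed.

Section ClassPolynomials.

Variables (H : algType laurent) (T : eaw -> H).
Hypothesis hT : is_hecke_basis T.

Lemma class_sum (r : seq (set eaw)) (f : set eaw -> laurent) (x : set eaw -> eaw) :
  uniq r -> {in r, forall O, conj_classes O} ->
  (forall O, conj_classes O -> O \notin r -> f O = 0) ->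
  \sum_(O \in conj_classes) f O *: T (x O) = \sum_(O <- r) f O *: T (x O).
Proof.
move=> ur rC f0; rewrite (fsbigE r) //; last first.
  by move=> O OC Or; rewrite f0 ?scale0r.
rewrite big_seq_cond [RHS]big_seq; apply: eq_bigl => O.
by case: (boolP (O \in r)) => //= Or; rewrite mem_set //; exact: rC.
Qed.

(** Subtracting the two expansions gives a relation over the finite union of their supports, to
    which [class_basis_free] applies. *)
Lemma class_polynomials_unique w f h :
  is_class_polynomials T w f -> is_class_polynomials T w h ->
  forall O, conj_classes O -> f O = h O.
Proof.
move=> [ff hf] [fh hh].
have /choice[x hx] : forall O, exists x, conj_classes O -> min_length O x.
  move=> O; have [OC|OC] := pselect (conj_classes O).
    by have [y hy] := min_length_exists OC; exists y.
  by exists 1%g.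
have : finite_set ((conj_classes `&` [set O | f O <> 0]) `|`
    (conj_classes `&` [set O | h O <> 0])) by rewrite finite_setU.
move=> /finite_seqP[s hs].
have sP O : O \in undup s <-> conj_classes O /\ (f O <> 0 \/ h O <> 0).
  rewrite mem_undup; have := congr1 (fun A : set (set eaw) => A O) hs.
  rewrite -[X in _ = X]/(is_true (O \in s)) => <-.
  by split=> [[[? ?]|[? ?]]|[? [?|?]]]; [split=> //; left|split=> //; right|
    left|right].
have rC : {in undup s, forall O, conj_classes O} by move=> O /sP[].
have ur := undup_uniq s.
have z0 (e : set eaw -> laurent) : (forall O, e O <> 0 -> f O <> 0 \/ h O <> 0) ->
    forall O, conj_classes O -> O \notin undup s -> e O = 0.
  move=> ez O OC /negP Os; apply: contrapT => eO; apply: Os.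
  by apply/sP; split=> //; exact: ez.
have zf := z0 f (fun O => @or_introl _ _); have zh := z0 h (fun O => @or_intror _ _).
have d0 : {in undup s, forall O, f O - h O = 0}.
  (* The traces are taken over the algebraic numbers, which contain a primitive cube root of
     unity. *)
  have [zeta hz] := @C_prim_root_exists 3 isT.
  apply: (class_basis_free hz ur rC (x := x) _ hT) => [O /rC /hx[]//|].
  under eq_bigr do rewrite scalerBl.
  rewrite sumrB -!(class_sum x ur rC) //.
  have := commutatorsD (hh x hx) (commutatorsZ (-1) (hf x hx)).
  by rewrite scaleN1r opprB addrC addrA subrK.
move=> O OC; have [/d0/eqP|Os] := boolP (O \in undup s).
  by rewrite subr_eq0 => /eqP.
by rewrite zf ?zh.
Qed.

Lemma class_polynomials_intro w f (r : seq (set eaw)) :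
  uniq r -> {in r, forall O, conj_classes O} ->
  (forall O, conj_classes O -> O \notin r -> f O = 0) ->
  (forall x : set eaw -> eaw, {in r, forall O, min_length O (x O)} ->
    cong (T w) (\sum_(O <- r) f O *: T (x O))) ->
  is_class_polynomials T w f.
Proof.
move=> ur rC f0 hf; split.
  apply: (@sub_finite_set _ _ [set` r]) => // O [OC fO] /=.
  by apply: contrapT => /negP Or; apply: fO; exact: f0.
move=> x hx; rewrite (class_sum x ur rC f0); apply: hf => O Or.
exact/hx/rC.
Qed.

Lemma class_polynomials_eq w f h :
  (forall O, conj_classes O -> f O = h O) ->
  is_class_polynomials T w h -> is_class_polynomials T w f.
Proof.
move=> fh [fin hh]; split.
  by apply: sub_finite_set fin => O [OC fO]; split=> //=; rewrite -fh.
move=> x hx; have := hh x hx; congr (commutators (_ - _)).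
by apply: eq_fsbigr => O /set_mem OC; rewrite fh.
Qed.

End ClassPolynomials.

(** * Separating the classes of the expansion *)

Lemma conj_class_t l y : conj_class (EAW l 1%g) y -> exists w, y = EAW (act w l) 1%g.
Proof.
move=> [[k w] _ <-]; exists w.
have -> : EAW k w = (t k * EAW 0 w)%g by rewrite t_mul addr0.
rewrite invMg !mulgA -(mulgA (t k)) -(mulgA (t k)) conj_fin mulg1 mulgV conj_t act1.
by rewrite subrr addr0.
Qed.

Lemma act_tau a b : act (eaw_fin tau) (a, b) = (- (a + b), a).
Proof. by rewrite /act !tau_fin /coord [nth _ _ _]/=; congr pair => /=; ring. Qed.

Lemma act_S3 w a b :
  [\/ act w (a, b) = (a, b), act w (a, b) = (- (a + b), a) |
      act w (a, b) = (b, - (a + b))] \/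
  [\/ act w (a, b) = (- a, a + b), act w (a, b) = (a + b, - b) |
      act w (a, b) = (- b, - a)].
Proof.
case: (S3_cases w) => -[] ->; [left|left|left|right|right|right].
- by constructor 1; rewrite act1.
- by constructor 2; exact: act_tau.
- by constructor 3; rewrite actM !act_tau; congr pair; ring.
- by constructor 1; rewrite /act !s1_fin /coord /=; congr pair; ring.
- by constructor 2; rewrite /act !s2_fin /coord /=; congr pair; ring.
- by constructor 3; rewrite /act !s0_fin /coord /=; congr pair; ring.
Qed.

(** The finite part of [s1] exchanges k and i - k; the bound by [base i] selects one from each pair,
    and the other Weyl images give no further coincidence. *)
Lemma trans_elt_inj i k k' : base i <= k -> base i <= k' ->
  conj_class (trans_elt i k) (trans_elt i k') -> k = k'.
Proof.
rewrite /base => hk hk' /conj_class_t[w /(congr1 eaw_trans)].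
rewrite -[LHS]/(2 * k' - i, 2 * i - k' - 1) => e.
by case: (act_S3 w (2 * k - i) (2 * i - k - 1)) => -[] h;
  move: e; rewrite [in X in X -> _]/= h => -[]; lia.
Qed.

Lemma refl_trans_neq i k l : conj_class (refl_elt i k) <> conj_class (EAW l 1%g).
Proof.
move=> e; have : conj_class (EAW l 1%g) (refl_elt i k).
  by rewrite -e; exact: conj_class_refl.
move=> /conj_class_t[w [_ _ /(congr1 (fun u : 'S_3 => u 0))]].
by rewrite (s1_fin.1.1) perm1.
Qed.

(** The common form of both formulas. The reduction shows that the displayed function is a solution,
    and uniqueness gives the equivalence. *)
Lemma class_polynomials_main (H : algType laurent) (T : eaw -> H)
    (hT : is_hecke_basis T) (w : eaw) (i : int) (N : nat) (Q : set eaw -> Prop) :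
  flip_range i (base i + N%:Z) ->
  cong (T w) (T (refl_elt i (base i + N%:Z))) ->
  (forall O, Q O <-> exists2 j : nat, (j < N)%N &
    O = conj_class (trans_elt i (base i + j%:Z))) ->
  forall f, is_class_polynomials T w f <-> forall O, conj_classes O ->
    f O = if `[< Q O >] then v - vinv else if `[< O = Oint_tau i >] then 1 else 0.
Proof.
move=> range cw QE f.
pose h O : laurent :=
  if `[< Q O >] then v - vinv else if `[< O = Oint_tau i >] then 1 else 0.
pose cls (j : nat) := conj_class (trans_elt i (base i + j%:Z)).
pose r := Oint_tau i :: [seq cls j | j <- iota 0 N].
have OiE := Oint_conj i (base i).
have notQ : ~ Q (Oint_tau i).
  by move=> /QE[j _]; rewrite OiE; exact: refl_trans_neq.
have hcls j : j \in iota 0 N -> h (cls j) = v - vinv.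
  rewrite mem_iota add0n => jN; rewrite /h; case: asboolP => // nQ.
  by case: nQ; apply/QE; exists j.
have hOi : h (Oint_tau i) = 1.
  by rewrite /h; case: asboolP => // _; case: asboolP.
have hh : is_class_polynomials T w h.
  apply: (class_polynomials_intro (r := r)).
  - rewrite /= map_inj_in_uniq ?iota_uniq ?andbT => [|j j' _ _ e].
      apply/mapP => -[j _]; rewrite OiE; exact: refl_trans_neq.
    have : base i + j%:Z = base i + j'%:Z.
      apply: (@trans_elt_inj i); rewrite ?lerDl // -[conj_class _]/(cls j) e.
      exact: conj_class_refl.
    by move=> /addrI[].
  - move=> O; rewrite inE => /orP[/eqP->|/mapP[j _ ->]].
      by rewrite OiE; eexists.
    by eexists.
  - move=> O _; rewrite inE negb_or => /andP[/eqP O1 /mapP O2].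
    rewrite /h; case: asboolP => [/QE[j jN e]|_]; last by case: asboolP.
    by case: O2; exists j; rewrite // mem_iota.
  move=> x hx; apply: cong_trans cw _; apply: cong_trans (cong_reduce hT range) _.
  rewrite big_cons hOi scale1r big_map scaler_sumr.
  apply: congD.
    by apply/cong_sym/(cong_min_refl hT)/hx; rewrite mem_head.
  apply: cong_sum => j jN; rewrite hcls //; apply/congZ/cong_sym.
  apply: cong_trans_class => //.
  have [] // : min_length (cls j) (x (cls j)).
  by apply: hx; rewrite inE map_f ?orbT.
split=> [hf O OC|hf]; first exact: class_polynomials_unique hf hh O OC.
exact: class_polynomials_eq hf hh.
Qed.

(** The walls of the dominant chamber meet [Qlat] in multiples of $\alpha_1+2\alpha_2$ and
    $2\alpha_1+\alpha_2$, which [Qsh] excludes. *)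
Lemma Pplus_Qsh_strict m n : (Pplus `&` Qsh) (qvec m n) ->
  0 < 2 * m - n /\ 0 < 2 * n - m.
Proof.
rewrite qvecE => -[[/= m0 n0] [_ sh]]; split.
  rewrite lt_def m0 andbT; apply/eqP => e; apply: sh; exists m; constructor 1.
  by rewrite mulrz_pair -[RHS]/(0 * m, 3 * m); congr pair; lia.
rewrite lt_def n0 andbT; apply/eqP => e; apply: sh; exists n; constructor 2.
by rewrite mulrz_pair -[RHS]/(3 * n, 0 * n); congr pair; lia.
Qed.

Lemma Olam_trans_elt k i : Olam_tau (qvec k i) = conj_class (trans_elt i k).
Proof. by rewrite /Olam_tau trans_eltE. Qed.

(** Rotation by the square of the finite part of [tau] trades the fixed first coefficient m for the
    fixed index 1 - m, matching [refl_elt_tau]. *)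
Lemma Olam_trans_elt' m k :
  Olam_tau (qvec m k) = conj_class (trans_elt (1 - m) (k - m)).
Proof.
rewrite Olam_trans_elt; apply: conj_class_eq.
have -> : trans_elt (1 - m) (k - m) =
    EAW (act (eaw_fin tau * eaw_fin tau)%g (2 * m - k, 2 * k - m - 1)) 1%g.
  by rewrite actM (act_tau (2 * m - k)) act_tau; congr (EAW (_, _) _); ring.
set u := (eaw_fin tau * eaw_fin tau)%g.
by exists (EAW 0 u) => //; rewrite conj_fin mulg1 mulgV.
Qed.

Unset Implicit Arguments.

Theorem proposition2p23 (H : algType laurent) (T : eaw -> H)
    (hT : is_hecke_basis T) :
  (forall m n : int, (Pplus `&` Qsh) (qvec m n) ->
   forall f : set eaw -> laurent,
     is_class_polynomials T (t (qvec m n) * s1 * s2 * s1 * tau)%g f <->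
     (forall O : set eaw, conj_classes O ->
       f O = if `[< exists2 l, E_tau m n l & O = Olam_tau l >] then v - vinv
             else if `[< O = Oint_tau n >] then 1 else 0))
  /\
  (forall m n : int, (Pplus `&` Qsh) (qvec m n) -> n <> 2 * m ->
   forall f : set eaw -> laurent,
     is_class_polynomials T (t (qvec m n) * s1 * tau)%g f <->
     (forall O : set eaw, conj_classes O ->
       f O = if `[< exists2 l, E'_tau m n l & O = Olam_tau l >] then v - vinv
             else if `[< O = Oint_tau (1 - m) >] then 1 else 0)).
Proof.
split=> m n /Pplus_Qsh_strict[hm hn].
  (* Strict dominance gives 2m > n, so m - [base n] is a natural number, the number of reduction
     steps. *)
  have mE : m = base n + `|m - base n|%N by rewrite /base; lia.
  apply: (class_polynomials_main hT (N := `|m - base n|%N)).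
  - by rewrite -mE /flip_range; lia.
  - by rewrite -mE refl_eltE; exact: cong_refl.
  - move=> O; split=> [[_ [k hk <-] ->]|[j jN ->]].
      exists `|k - base n|%N; first by move: hk => /=; rewrite /base; lia.
      rewrite Olam_trans_elt; congr (conj_class (trans_elt _ _)).
      by move: hk => /=; rewrite /base; lia.
    exists (qvec (base n + j%:Z) n); last by rewrite Olam_trans_elt.
    by exists (base n + j%:Z) => //=; move: jN; rewrite /base; lia.
(* By [refl_elt_tau] the element is the [tau]-conjugate of [refl_elt i k]. *)
move=> _; pose i : int := 1 - m; pose k := n + i.
have kE : k = base i + `|k - base i|%N by rewrite /base /k /i; lia.
apply: (class_polynomials_main hT (N := `|k - base i|%N)).
(* Here i is at most 0, so the second alternative of [flip_range] holds, whereas the first formula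
   uses the first. *)
- by rewrite -kE /flip_range /k /i; lia.
- rewrite -kE; have -> : qvec m n = qvec (1 - i) n by rewrite /i subKr.
  rewrite refl_elt_tau; apply: cong_sym; exact: (cong_conj_tau hT).
- move=> O; split=> [[_ [l hl <-] ->]|[j jN ->]].
    (* [base (1 - m) + m] is the lower bound [((m + 1) %/ 2)%Z + 1] of [E'_tau], so this counts from
       the start of that range. *)
    exists `|(l - m - base i)%R|%N; first by move: hl => /=; rewrite /base /k /i; lia.
    rewrite Olam_trans_elt'; congr (conj_class (trans_elt _ _)).
    by move: hl => /=; rewrite /base /i; lia.
  exists (qvec m (base i + j%:Z + m)).
    by exists (base i + j%:Z + m) => //=; move: jN; rewrite /base /k /i; lia.
  by rewrite Olam_trans_elt' addrK.
Qed.
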